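(* Let $R$ be an exceptional prime ring with extended centroid $C$, and let $\delta,d$ be derivations of $R$. (i) If $d$ is X-inner and $\delta$ is X-outer, then $\delta d(R)\subseteq Z(R)$ if and only if $d=0$. (ii) If $d$ and $\delta$ are X-inner, then $\delta d(R)\subseteq Z(R)$ if and only if either $d=0$ or $\delta([R,R])\subseteq Z(R)$. (iii) If $d$ is X-outer and $\delta$ is X-inner, then $\delta d(R)\subseteq Z(R)$ if and only if $\delta=0$. (iv) If both $\delta$ and $d$ are X-outer, then $\delta d(R)\subseteq Z(R)$ if and only if there exists $\beta\in Z(R)$ such that neither $d(\beta)=0$ nor $\delta(\beta)=0$, $\delta(\beta)d=d(\beta)\delta$, and $d^2=0$.
   Context: Rings are associative, not necessarily unital; $Z(R)$ is the center of $R$. $[a,b]:=ab-ba$, and $[R,R]$ is the additive subgroup generated by all $[a,b]$, $a,b\in R$. For a prime ring $R$, let $Q_s(R)$ be its Martindale symmetric ring of quotients and $C$ (the extended centroid) the center of $Q_s(R)$, which is a field; $RC$ is the additive subgroup of $Q_s(R)$ generated by all $rc$, $r\in R$, $c\in C$. A prime ring $R$ is called exceptional if both $\mathrm{char}\,R=2$ and $\dim_C RC=4$. A derivation of $R$ is an additive map $d\colon R\to R$ with $d(xy)=xd(y)+d(x)y$; it extends uniquely to a derivation, also denoted $d$, of $Q_s(R)$, with $d(C)\subseteq C$. A derivation $d$ of $R$ is X-inner if its extension to $Q_s(R)$ is the map $x\mapsto [a,x]$ for some $a\in Q_s(R)$ (for exceptional $R$, $Q_s(R)=RC$), and X-outer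 otherwise. $\delta d$ and $d^2$ are compositions. *)

(* Defs.v *)
From HB Require Import structures.
From mathcomp Require Import all_boot all_algebra.
From mathcomp Require Import boolp classical_sets.

Set Implicit Arguments.
Unset Strict Implicit.
Unset Printing Implicit Defensive.

Import GRing.Theory.
Local Open Scope ring_scope.
Local Open Scope quotient_scope.

(* MathComp rings are unital, so associative rings without unit get their own *)
(* structure.  Its product is written x ** y.                                 *)

HB.mixin Record Zmodule_isRng R of GRing.Zmodule R := {
  rng_mul : R -> R -> R;
  rng_mulA : associative rng_mul;
  rng_mulDl : left_distributive rng_mul +%R;
  rng_mulDr : right_distributive rng_mul +%R
}.

#[short(type="rngType")]
HB.structure Definition Rng := {R of GRing.Zmodule R & Zmodule_isRng R}.

Notation "x ** y" := (rng_mul x y) (at level 40, left associativity) : ring_scope.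

HB.mixin Record Rng_isPrime R of Rng R := {
  prime_rng_neq0 : exists x : R, x <> 0;
  prime_rngP : forall a b : R, (forall r, a ** r ** b = 0) -> a = 0 \/ b = 0
}.

#[short(type="primeRngType")]
HB.structure Definition PrimeRng := {R of Rng R & Rng_isPrime R}.

Inductive add_span (V : zmodType) (S : set V) : set V :=
| add_span_gen x : S x -> add_span S x
| add_span0 : add_span S 0
| add_spanB x y : add_span S x -> add_span S y -> add_span S (x - y).

(* The product is a parameter so that the same notion applies to a rngType    *)
(* and to its (unital) ring of quotients.                                     *)
Definition is_derivation (V : zmodType) (mul : V -> V -> V) (d : V -> V) :=
  {morph d : x y / x + y} /\
  forall x y, d (mul x y) = mul x (d y) + mul (d x) y.

Section Rng.
Variable R : rngType.
Implicit Types x y : R.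

Definition rng_center : set R := [set z | forall x, z ** x = x ** z].

Definition rng_comm_sub : set R :=
  add_span [set z | exists x y, z = x ** y - y ** x].

Definition is_ideal (I : set R) :=
  [/\ I 0, forall x y, I x -> I y -> I (x - y) &
      forall r x, I x -> I (r ** x) /\ I (x ** r)].

Lemma rng_mul0l x : 0 ** x = 0.
Proof. by apply: (addrI (0 ** x)); rewrite -rng_mulDl !addr0. Qed.

Lemma rng_mul0r x : x ** 0 = 0.
Proof. by apply: (addrI (x ** 0)); rewrite -rng_mulDr !addr0. Qed.

Lemma rng_mulNl x y : (- x) ** y = - (x ** y).
Proof. by apply: (addrI (x ** y)); rewrite -rng_mulDl !subrr rng_mul0l. Qed.

Lemma rng_mulNr x y : x ** (- y) = - (x ** y).
Proof. by apply: (addrI (x ** y)); rewrite -rng_mulDr !subrr rng_mul0r. Qed.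

Lemma idealN I x : is_ideal I -> I x -> I (- x).
Proof. by case=> I0 IB _ Ix; rewrite -sub0r; apply: IB. Qed.

Lemma idealD I x y : is_ideal I -> I x -> I y -> I (x + y).
Proof.
move=> II Ix Iy; rewrite -[y]opprK; case: (II) => _ IB _.
by apply: IB => //; apply: idealN.
Qed.

End Rng.

(* The Martindale symmetric ring of quotients.  A germ is a pair (lf, rf)     *)
(* where, on a nonzero two-sided ideal dom, lf is a homomorphism of left      *)
(* modules, x |-> xq, and rf one of right modules, y |-> qy, subject to       *)
(* (xq)y = x(qy).  The values of lf and rf outside dom are irrelevant, and    *)
(* two germs are identified when they agree on some nonzero ideal.            *)

Local Obligation Tactic := idtac.

Section Germ.
Variable R : primeRngType.
Implicit Types (x y r : R) (I J : set R).

Definition nz_ideal I := is_ideal I /\ exists2 x, I x & x <> 0.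

Record germ := Germ {
  dom : set R;
  lf : R -> R;
  rf : R -> R;
  dom_nz : nz_ideal dom;
  lfD : forall x y, dom x -> dom y -> lf (x + y) = lf x + lf y;
  lfM : forall r x, dom x -> lf (r ** x) = r ** lf x;
  rfD : forall x y, dom x -> dom y -> rf (x + y) = rf x + rf y;
  rfM : forall x r, dom x -> rf (x ** r) = rf x ** r;
  lrf : forall x y, dom x -> dom y -> lf x ** y = x ** rf y
}.
Implicit Types p q s : germ.

HB.instance Definition _ := gen_eqMixin germ.
HB.instance Definition _ := gen_choiceMixin germ.

Definition germ_eq p q := exists2 I, nz_ideal I &
  forall x, I x -> [/\ dom p x, dom q x, lf p x = lf q x & rf p x = rf q x].

Lemma nz_idealI I J : nz_ideal I -> nz_ideal J -> nz_ideal (I `&` J)%classic.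
Proof.
move=> [[I0 IB IM] [a Ia a0]] [[J0 JB JM] [b Jb b0]]; split.
  split=> [|x y [? ?] [? ?]|r x [Ix Jx]]; first by [].
    by split; [apply: IB | apply: JB].
  by split; split; [case: (IM r x Ix) | case: (JM r x Jx)
                   |case: (IM r x Ix) | case: (JM r x Jx)].
have [r rP] : exists r, a ** r ** b <> 0.
  apply/existsNP => h; case: (@prime_rngP R _ _ h) => //.
exists (a ** r ** b) => //; split; last by case: (JM (a ** r) b Jb).
by case: (IM r a Ia) => _ h; case: (IM b _ h).
Qed.

Lemma nz_idealT : nz_ideal setT.
Proof. by split; last by have [x x0] := @prime_rng_neq0 R; exists x. Qed.

Lemma dom_ideal p : is_ideal (dom p). Proof. by case: (dom_nz p). Qed.
Lemma domD p x y : dom p x -> dom p y -> dom p (x + y).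
Proof. by apply: idealD; apply: dom_ideal. Qed.
Lemma domN p x : dom p x -> dom p (- x).
Proof. by apply: idealN; apply: dom_ideal. Qed.
Lemma dom0 p : dom p 0. Proof. by case: (dom_ideal p). Qed.
Lemma domMl p r x : dom p x -> dom p (r ** x).
Proof. by case: (dom_ideal p) => _ _ h /(h r) []. Qed.
Lemma domMr p x r : dom p x -> dom p (x ** r).
Proof. by case: (dom_ideal p) => _ _ h /(h r) []. Qed.

Lemma lf0 p : lf p 0 = 0.
Proof.
apply: (addrI (lf p 0)).
by rewrite -lfD ?addr0 //; apply: dom0.
Qed.
Lemma rf0 p : rf p 0 = 0.
Proof.
apply: (addrI (rf p 0)).
by rewrite -rfD ?addr0 //; apply: dom0.
Qed.
Lemma lfN p x : dom p x -> lf p (- x) = - lf p x.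
Proof.
move=> px; apply: (addrI (lf p x)).
by rewrite -lfD ?subrr ?lf0 //; apply: domN.
Qed.
Lemma rfN p x : dom p x -> rf p (- x) = - rf p x.
Proof.
move=> px; apply: (addrI (rf p x)).
by rewrite -rfD ?subrr ?rf0 //; apply: domN.
Qed.

Lemma germ_eqP p q :
  (forall x, dom p x -> dom q x -> lf p x = lf q x /\ rf p x = rf q x) ->
  germ_eq p q.
Proof.
move=> h; exists (dom p `&` dom q)%classic.
  by apply: nz_idealI; apply: dom_nz.
by move=> x [px qx]; case: (h x px qx).
Qed.

Lemma germ_eq_refl p : germ_eq p p.
Proof. exact: germ_eqP. Qed.

Lemma germ_eq_sym p q : germ_eq p q -> germ_eq q p.
Proof. by case=> I nI h; exists I => // x /h []. Qed.

Lemma germ_eq_trans p q s : germ_eq p q -> germ_eq q s -> germ_eq p s.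
Proof.
case=> I nI hI [J nJ hJ]; exists (I `&` J)%classic; first exact: nz_idealI.
by move=> x [/hI [? ? -> ->] /hJ [? ? -> ->]].
Qed.

Definition germ_rel : rel germ := fun p q => `[< germ_eq p q >].

Lemma germ_rel_refl : reflexive germ_rel.
Proof. by move=> p; apply/asboolP/germ_eq_refl. Qed.
Lemma germ_rel_sym : symmetric germ_rel.
Proof. by move=> p q; apply/asboolP/asboolP; apply: germ_eq_sym. Qed.
Lemma germ_rel_trans : transitive germ_rel.
Proof. by move=> q p s /asboolP pq /asboolP qs; apply/asboolP/(germ_eq_trans pq). Qed.

Canonical germ_equiv := EquivRel germ_rel germ_rel_refl germ_rel_sym germ_rel_trans.

Program Definition germ_of (a : R) : germ :=
  @Germ setT (fun x => x ** a) (fun x => a ** x) nz_idealT _ _ _ _ _.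
Next Obligation. by move=> a x y _ _ /=; rewrite rng_mulDl. Qed.
Next Obligation. by move=> a x y _ /=; rewrite rng_mulA. Qed.
Next Obligation. by move=> a x y _ _ /=; rewrite rng_mulDr. Qed.
Next Obligation. by move=> a x y _ /=; rewrite rng_mulA. Qed.
Next Obligation. by move=> a x y _ _ /=; rewrite rng_mulA. Qed.

Program Definition germ1 : germ := @Germ setT id id nz_idealT _ _ _ _ _.
Solve All Obligations with done.

Program Definition germ_opp p : germ :=
  @Germ (dom p) (fun x => - lf p x) (fun x => - rf p x) (dom_nz p) _ _ _ _ _.
Next Obligation. by move=> p x y px py /=; rewrite lfD // opprD. Qed.
Next Obligation. by move=> p x y py /=; rewrite lfM // rng_mulNr. Qed.
Next Obligation. by move=> p x y px py /=; rewrite rfD // opprD. Qed.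
Next Obligation. by move=> p x y px /=; rewrite rfM // rng_mulNl. Qed.
Next Obligation. by move=> p x y px py /=; rewrite rng_mulNl rng_mulNr lrf. Qed.

Program Definition germ_add p q : germ :=
  @Germ (dom p `&` dom q)%classic (fun x => lf p x + lf q x)
    (fun x => rf p x + rf q x) (nz_idealI (dom_nz p) (dom_nz q)) _ _ _ _ _.
Next Obligation. by move=> p q x y [? ?] [? ?] /=; rewrite !lfD // addrACA. Qed.
Next Obligation. by move=> p q x y [? ?] /=; rewrite !lfM // rng_mulDr. Qed.
Next Obligation. by move=> p q x y [? ?] [? ?] /=; rewrite !rfD // addrACA. Qed.
Next Obligation. by move=> p q x y [? ?] /=; rewrite !rfM // rng_mulDl. Qed.
Next Obligation.
by move=> p q x y [? ?] [? ?] /=; rewrite rng_mulDl rng_mulDr !lrf.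
Qed.

(* x |-> xp need not map a two-sided ideal into dom q; this is the largest    *)
(* ideal on which both composites are defined.  It contains all products of   *)
(* two elements of dom p `&` dom q.                                           *)
Definition comp_dom p q : set R := [set x |
  [/\ dom p x, dom q x,
      dom q (lf p x) /\ forall r, dom q (lf p (x ** r)) &
      dom p (rf q x) /\ forall r, dom p (rf q (r ** x))]].

Lemma comp_dom_nz p q : nz_ideal (comp_dom p q).
Proof.
have [_ [a [pa qa] a0]] := nz_idealI (dom_nz p) (dom_nz q).
split; first split.
- split; [exact: dom0|exact: dom0|split|split].
  + by rewrite lf0; apply: dom0.
  + by move=> r; rewrite rng_mul0l lf0; apply: dom0.
  + by rewrite rf0; apply: dom0.
  + by move=> r; rewrite rng_mul0r rf0; apply: dom0.
- move=> x y [px qx [lx lxr] [rx rrx]] [py qy [ly lyr] [ry rry]]; split.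
  + by apply/domD/domN.
  + by apply/domD/domN.
  + split=> [|r].
      by rewrite lfD ?lfN //; [apply/domD/domN|apply: domN].
    rewrite rng_mulDl rng_mulNl lfD ?lfN;
      by [apply/domD/domN | apply: domMr | apply/domN/domMr].
  + split=> [|r].
      by rewrite rfD ?rfN //; [apply/domD/domN|apply: domN].
    rewrite rng_mulDr rng_mulNr rfD ?rfN;
      by [apply/domD/domN | apply: domMl | apply/domN/domMl].
- move=> r x [px qx [lx lxr] [rx rrx]]; split; split.
  + exact: domMl.
  + exact: domMl.
  + split=> [|t]; first by rewrite lfM //; apply: domMl.
    by rewrite -rng_mulA lfM; [apply: domMl | apply: domMr].
  + by split=> // t; rewrite rng_mulA.
  + exact: domMr.
  + exact: domMr.
  + by split=> // t; rewrite -rng_mulA.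
  + split=> [|t]; first by rewrite rfM //; apply: domMr.
    by rewrite rng_mulA rfM; [apply: domMr | apply: domMl].
have [r rP] : exists r, a ** r ** a <> 0.
  by apply/existsNP => h; case: (@prime_rngP R _ _ h).
exists (a ** r ** a) => //; split; try exact: domMl.
- split=> [|t]; first by rewrite lfM //; apply/domMr/domMr.
  by rewrite -(rng_mulA _ a t) lfM; [apply/domMr/domMr | apply: domMr].
- split=> [|t]; first by rewrite -rng_mulA rfM //; apply/domMl/domMl.
  by rewrite -rng_mulA rng_mulA rfM; [apply/domMl/domMl | apply: domMl].
Qed.

Program Definition germ_mul p q : germ :=
  @Germ (comp_dom p q) (fun x => lf q (lf p x)) (fun x => rf p (rf q x))
    (comp_dom_nz p q) _ _ _ _ _.
Next Obligation.
by move=> p q x y [px qx [lx _] _] [py qy [ly _] _] /=; rewrite !lfD.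
Qed.
Next Obligation. by move=> p q r x [px qx [lx _] _] /=; rewrite !lfM. Qed.
Next Obligation.
by move=> p q x y [px qx _ [rx _]] [py qy _ [ry _]] /=; rewrite !rfD.
Qed.
Next Obligation. by move=> p q x r [px qx _ [rx _]] /=; rewrite !rfM. Qed.
Next Obligation.
move=> p q x y [px qx [lx _] _] [py qy _ [ry _]] /=.
by rewrite lrf // lrf.
Qed.

Lemma germ_opp_eq p p' : germ_eq p p' -> germ_eq (germ_opp p) (germ_opp p').
Proof. by case=> I nI h; exists I => // x /h [? ? /= -> ->]. Qed.

Lemma germ_add_eq p p' q q' : germ_eq p p' -> germ_eq q q' ->
  germ_eq (germ_add p q) (germ_add p' q').
Proof.
case=> I nI hI [J nJ hJ]; exists (I `&` J)%classic; first exact: nz_idealI.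
by move=> x [/hI [? ? /= -> ->] /hJ [? ? -> ->]].
Qed.

Program Definition germ_restr p I (nI : nz_ideal I)
    (IP : (I `<=` dom p)%classic) : germ :=
  @Germ I (lf p) (rf p) nI _ _ _ _ _.
Next Obligation. by move=> p I _ IP x y /IP ? /IP ?; apply: lfD. Qed.
Next Obligation. by move=> p I _ IP r x /IP ?; apply: lfM. Qed.
Next Obligation. by move=> p I _ IP x y /IP ? /IP ?; apply: rfD. Qed.
Next Obligation. by move=> p I _ IP x r /IP ?; apply: rfM. Qed.
Next Obligation. by move=> p I _ IP x y /IP ? /IP ?; apply: lrf. Qed.

Lemma germ_mul_eq p p' q q' : germ_eq p p' -> germ_eq q q' ->
  germ_eq (germ_mul p q) (germ_mul p' q').
Proof.
case=> I nI hI [J nJ hJ].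
have IP : (I `<=` dom p)%classic by move=> x /hI [].
have JP : (J `<=` dom q)%classic by move=> x /hJ [].
have [II _] := nI; have [JI _] := nJ.
exists (comp_dom (germ_restr nI IP) (germ_restr nJ JP)).
  exact: comp_dom_nz.
move=> x [/= Ix Jx [lx lxr] [rx rrx]].
have [px p'x ep1 ep2] := hI _ Ix; have [qx q'x eq1 eq2] := hJ _ Jx.
have Ir r : I (x ** r) by case: II => _ _ /(_ r x Ix) [].
have Jr r : J (r ** x) by case: JI => _ _ /(_ r x Jx) [].
split.
- by split=> //; split=> [|r]; first [exact: JP|exact: IP].
- split=> //; split=> [|r]; rewrite -?ep1 -?eq2.
  + by case: (hJ _ lx).
  + by case: (hI _ (Ir r)) => _ _ <- _; case: (hJ _ (lxr r)).
  + by case: (hI _ rx).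
  + by case: (hJ _ (Jr r)) => _ _ _ <-; case: (hI _ (rrx r)).
- by rewrite -ep1; case: (hJ _ lx).
- by rewrite -eq2; case: (hI _ rx).
Qed.

End Germ.

Definition Qs (R : primeRngType) : Type := {eq_quot germ_equiv R}.

Section SymmetricQuotients.
Variable R : primeRngType.
Local Notation Q := (Qs R).
Implicit Types (p q : germ R) (x y z : Q).

HB.instance Definition _ := Choice.on Q.
HB.instance Definition _ := EqQuotient.on Q.

Lemma Qs_eqP p q : germ_eq p q <-> \pi_Q p = \pi_Q q.
Proof.
split=> [h|]; first by apply/eqmodP/asboolP.
by move/eqmodP/asboolP.
Qed.

Lemma germ_eq_repr p : germ_eq (repr (\pi_Q p)) p.
Proof. by apply/Qs_eqP; rewrite reprK. Qed.

Definition Qs_zero : Q := \pi_Q (germ_of (0 : R)).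
Definition Qs_one : Q := \pi_Q (germ1 R).
Definition Qs_opp x : Q := \pi_Q (germ_opp (repr x)).
Definition Qs_add x y : Q := \pi_Q (germ_add (repr x) (repr y)).
Definition Qs_mul x y : Q := \pi_Q (germ_mul (repr x) (repr y)).

Lemma pi_Qs_opp p : Qs_opp (\pi_Q p) = \pi_Q (germ_opp p).
Proof. by apply/Qs_eqP/germ_opp_eq; apply: germ_eq_repr. Qed.

Lemma pi_Qs_add p q : Qs_add (\pi_Q p) (\pi_Q q) = \pi_Q (germ_add p q).
Proof. by apply/Qs_eqP/germ_add_eq; apply: germ_eq_repr. Qed.

Lemma pi_Qs_mul p q : Qs_mul (\pi_Q p) (\pi_Q q) = \pi_Q (germ_mul p q).
Proof. by apply/Qs_eqP/germ_mul_eq; apply: germ_eq_repr. Qed.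

Lemma Qs_addA : associative Qs_add.
Proof.
elim/quotW=> p; elim/quotW=> q; elim/quotW=> s; rewrite (pi_Qs_add q s) (pi_Qs_add p q).
rewrite (pi_Qs_add p) (pi_Qs_add _ s).
by apply/Qs_eqP/germ_eqP => a _ _ /=; rewrite !addrA.
Qed.

Lemma Qs_addC : commutative Qs_add.
Proof.
elim/quotW=> p; elim/quotW=> q; rewrite (pi_Qs_add p q) (pi_Qs_add q p).
by apply/Qs_eqP/germ_eqP => a _ _ /=; rewrite addrC (addrC (rf p a)).
Qed.

Lemma Qs_add0 : left_id Qs_zero Qs_add.
Proof.
elim/quotW=> p; rewrite pi_Qs_add; apply/Qs_eqP/germ_eqP => a _ _ /=.
by rewrite rng_mul0r rng_mul0l !add0r.
Qed.

Lemma Qs_addN : left_inverse Qs_zero Qs_opp Qs_add.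
Proof.
elim/quotW=> p; rewrite pi_Qs_opp pi_Qs_add.
by apply/Qs_eqP/germ_eqP => a _ _ /=; rewrite rng_mul0r rng_mul0l !addNr.
Qed.

HB.instance Definition _ := GRing.isZmodule.Build Q Qs_addA Qs_addC Qs_add0 Qs_addN.

Lemma Qs_mulA : associative Qs_mul.
Proof.
elim/quotW=> p; elim/quotW=> q; elim/quotW=> s; rewrite (pi_Qs_mul q s) (pi_Qs_mul p q).
rewrite (pi_Qs_mul p) (pi_Qs_mul _ s).
by apply/Qs_eqP/germ_eqP.
Qed.

Lemma Qs_mul1l : left_id Qs_one Qs_mul.
Proof. by elim/quotW=> p; rewrite pi_Qs_mul; apply/Qs_eqP/germ_eqP. Qed.

Lemma Qs_mul1r : right_id Qs_one Qs_mul.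
Proof. by elim/quotW=> p; rewrite pi_Qs_mul; apply/Qs_eqP/germ_eqP. Qed.

Lemma Qs_mulDl : left_distributive Qs_mul Qs_add.
Proof.
elim/quotW=> p; elim/quotW=> q; elim/quotW=> s; rewrite (pi_Qs_add p q).
rewrite !(pi_Qs_mul _ s) pi_Qs_add.
apply/Qs_eqP/germ_eqP => a [/= [? ?] ? _ _] [[? ? [? _] _] [_ _ [? _] _]].
by rewrite lfD.
Qed.

Lemma Qs_mulDr : right_distributive Qs_mul Qs_add.
Proof.
elim/quotW=> p; elim/quotW=> q; elim/quotW=> s; rewrite (pi_Qs_add q s).
rewrite !(pi_Qs_mul p) pi_Qs_add.
apply/Qs_eqP/germ_eqP => a [/= _ [? ?] _ _] [[? ? _ [? _]] [_ _ _ [? _]]].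
by rewrite rfD.
Qed.

Lemma Qs_one_neq0 : Qs_one != 0.
Proof.
apply/eqP => /Qs_eqP [I [_ [a Ia a0]] /(_ a Ia) [_ _ /= e _]].
by apply: a0; rewrite e rng_mul0r.
Qed.

HB.instance Definition _ := GRing.Zmodule_isNzRing.Build Q
  Qs_mulA Qs_mul1l Qs_mul1r Qs_mulDl Qs_mulDr Qs_one_neq0.

Definition Qs_of (a : R) : Q := \pi_Q (germ_of a).

Lemma Qs_of_inj : injective Qs_of.
Proof.
move=> a b /Qs_eqP [I [[I0 IB IM] [c Ic c0]] h].
apply/subr0_eq; case: (@prime_rngP R c (a - b)) => // r.
have /h [_ _ /= e _] : I (c ** r) by case: (IM r c Ic).
by rewrite rng_mulDr rng_mulNr e subrr.
Qed.

(* With injectivity, the following lemmas are the usual characterization of   *)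
(* the symmetric ring of quotients: it contains R as a subring, each element  *)
(* maps some nonzero ideal into R from both sides, elements killing a nonzero *)
(* ideal vanish, and each germ is realized by multiplication by an element.   *)
Lemma Qs_ofD : {morph Qs_of : a b / a + b}.
Proof.
move=> a b; rewrite [RHS]pi_Qs_add; apply/Qs_eqP/germ_eqP => c _ _ /=.
by rewrite rng_mulDl rng_mulDr.
Qed.

Lemma Qs_ofM : {morph Qs_of : a b / a ** b >-> a * b}.
Proof.
move=> a b; rewrite [RHS]pi_Qs_mul; apply/Qs_eqP/germ_eqP => c _ _ /=.
by rewrite !rng_mulA.
Qed.

Lemma Qs_of_lf p a : dom p a -> Qs_of a * \pi_Q p = Qs_of (lf p a).
Proof.
move=> pa; rewrite [LHS]pi_Qs_mul; apply/Qs_eqP/germ_eqP => c [_ pc _ _] _ /=.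
by rewrite lfM // lrf.
Qed.

Lemma Qs_of_rf p a : dom p a -> \pi_Q p * Qs_of a = Qs_of (rf p a).
Proof.
move=> pa; rewrite [LHS]pi_Qs_mul; apply/Qs_eqP/germ_eqP => c [pc _ _ _] _ /=.
by rewrite rfM // lrf.
Qed.

Lemma Qs_absorb x : exists2 I, nz_ideal I & forall a, I a ->
  (exists b, Qs_of a * x = Qs_of b) /\ (exists b, x * Qs_of a = Qs_of b).
Proof.
elim/quotW: x => p; exists (dom p) => [|a pa]; first exact: dom_nz.
by split; [exists (lf p a); apply: Qs_of_lf | exists (rf p a); apply: Qs_of_rf].
Qed.

Lemma Qs_faithful_l I x : nz_ideal I ->
  (forall a, I a -> Qs_of a * x = 0) -> x = 0.
Proof.
elim/quotW: x => p nI h; apply/Qs_eqP.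
have [[_ _ KM] [b Kb b0]] := nz_idealI nI (dom_nz p).
have lf_eq0 a : I a -> dom p a -> lf p a = 0.
  by move=> Ia pa; apply: Qs_of_inj; rewrite -Qs_of_lf // h.
exists (I `&` dom p)%classic; first exact/nz_idealI/dom_nz.
move=> a [Ia pa]; split=> //=; first by rewrite rng_mul0r lf_eq0.
rewrite rng_mul0l; case: (@prime_rngP R b (rf p a)) => // r.
have [_ [Ibr pbr]] := KM r b Kb.
by rewrite -lrf // lf_eq0 // rng_mul0l.
Qed.

Lemma Qs_faithful_r I x : nz_ideal I ->
  (forall a, I a -> x * Qs_of a = 0) -> x = 0.
Proof.
elim/quotW: x => p nI h; apply/Qs_eqP.
have [[_ _ KM] [b Kb b0]] := nz_idealI nI (dom_nz p).
have rf_eq0 a : I a -> dom p a -> rf p a = 0.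
  by move=> Ia pa; apply: Qs_of_inj; rewrite -Qs_of_rf // h.
exists (I `&` dom p)%classic; first exact/nz_idealI/dom_nz.
move=> a [Ia pa]; split=> //=; last by rewrite rng_mul0l rf_eq0.
rewrite rng_mul0r; case: (@prime_rngP R (lf p a) b) => // r.
have [[Irb prb] _] := KM r b Kb.
by rewrite -rng_mulA lrf // rf_eq0 // rng_mul0r.
Qed.

Definition ext_centroid : set Q := [set c | forall x, c * x = x * c].

Definition central_closure : set Q :=
  add_span [set z | exists a c, ext_centroid c /\ z = Qs_of a * c].

Definition ext_centroid_dim (V : set Q) (n : nat) :=
  exists v : 'I_n -> Q,
    [/\ forall i, V (v i),
        forall c : 'I_n -> Q, (forall i, ext_centroid (c i)) ->
          \sum_i c i * v i = 0 -> forall i, c i = 0 &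
        forall x, V x -> exists2 c : 'I_n -> Q,
          forall i, ext_centroid (c i) & x = \sum_i c i * v i].

(* The prime ring R is nonzero, so char R = 2 amounts to 2R = 0. *)
Definition exceptional :=
  (forall a : R, a *+ 2 = 0) /\ ext_centroid_dim central_closure 4.

Definition extends_to_Qs (d : R -> R) (D : Q -> Q) :=
  is_derivation *%R D /\ forall a, D (Qs_of a) = Qs_of (d a).

Definition X_inner (d : R -> R) :=
  exists2 D : Q -> Q, extends_to_Qs d D &
    exists a : Q, forall x, D x = a * x - x * a.

Definition X_outer (d : R -> R) := ~ X_inner d.

End SymmetricQuotients.

Arguments exceptional : clear implicits.

(* Main.v *)
(* The symmetric ring of quotients Q of an exceptional prime ring is a central
   simple algebra of dimension 4 over C: by Martindale's lemma the 16 maps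
   x |-> v_i x v_j attached to a basis of RC are independent, hence span all
   C-linear maps, which puts 1, and then Q, inside RC.  Some noncentral x
   satisfies x^2 = x + n, and Q = C + Cx + W with W = {w | [x,w] = w}, where
   w^2 is in C.  In these coordinates C-linear derivations are inner, and
   every condition of the form [b,[a,y]] in C or [e,y] + ly in C can be read
   off.  Since commutators of commutators are central, Z(R) is large enough
   for an outer derivation to be nonzero on it; replacing x by zx with z in
   Z(R) in the hypothesis delta(d(x)) in C then gives
   delta(z)d(x) + d(z)delta(x) + delta(d(z))x in C, from which all four cases
   follow. *)

From HB Require Import structures.
Require Import Defs.
From mathcomp Require Import all_boot all_algebra all_field.
From mathcomp Require Import boolp classical_sets zify.

Set Implicit Arguments.
Unset Strict Implicit.
Unset Printing Implicit Defensive.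

Import GRing.Theory.
Local Open Scope ring_scope.
Local Open Scope quotient_scope.

(** * Extended centroid *)

Section Centroid.
Variable R : primeRngType.
Local Notation Q := (Qs R).
Implicit Types (I J : set R).

Lemma Qs_ofN (a : R) : Qs_of (- a) = - Qs_of a.
Proof. by apply: (addrI (Qs_of a)); rewrite -Qs_ofD !subrr. Qed.

Lemma Qs_of0 : Qs_of (0 : R) = 0.
Proof. by []. Qed.

Lemma Qs_of_eq0 (a : R) : Qs_of a = 0 -> a = 0.
Proof. by rewrite -Qs_of0 => /Qs_of_inj. Qed.

(** If both factors were nonzero, absorbing ideals would give nonzero [b = a x] and [e = y c] in
    [R]. With [i] a nonzero element of [I], the products [b r i s e] all vanish, and primeness of
    [R] applied twice is a contradiction. *)
Lemma Qs_prime I (x y : Q) : nz_ideal I ->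
  (forall a, I a -> x * Qs_of a * y = 0) -> x = 0 \/ y = 0.
Proof.
move=> nI h; apply: contrapT => /not_orP [x0 y0].
have [J nJ hJ] := Qs_absorb x; have [K nK hK] := Qs_absorb y.
have [nIJ nIK] := (nz_idealI nI nJ, nz_idealI nI nK).
have [a [Ja [b eb]] b0] : exists2 a : R, J a /\ (exists b, Qs_of a * x = Qs_of b) &
    Qs_of a * x <> 0.
  apply: contrapT => H; apply: x0; apply: (Qs_faithful_l nJ) => a Ja.
  apply: contrapT => n; apply: H; exists a => //; split=> //.
  by case: (hJ a Ja).
have [c [Kc [e ee]] e0] : exists2 a : R, K a /\ (exists b, y * Qs_of a = Qs_of b) &
    y * Qs_of a <> 0.
  apply: contrapT => H; apply: y0; apply: (Qs_faithful_r nK) => c Kc.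
  apply: contrapT => n; apply: H; exists c => //; split=> //.
  by case: (hK c Kc).
have [[_ _ IM] [i Ii i0]] := nI.
have key r s : b ** (r ** i ** s) ** e = 0.
  apply: Qs_of_inj; rewrite Qs_of0 !Qs_ofM -eb -ee.
  have /h E : I (r ** i ** s) by case: (IM r i Ii) => /(IM s) [].
  have -> : Qs_of a * x * (Qs_of r * Qs_of i * Qs_of s) * (y * Qs_of c) =
    Qs_of a * (x * Qs_of (r ** i ** s) * y) * Qs_of c by rewrite !Qs_ofM !mulrA.
  by rewrite E mulr0 mul0r.
have bi0 r : b ** r ** i = 0.
  case: (@prime_rngP R (b ** r ** i) e) => // [s|e0'].
    by rewrite -!rng_mulA !rng_mulA -(rng_mulA b r) -(rng_mulA b) key.
  by case: e0; rewrite ee e0' Qs_of0.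
case: (@prime_rngP R b i) => // b0'.
by apply: b0; rewrite eb b0' Qs_of0.
Qed.

Definition centroid_pred : {pred Q} := [pred c | `[< ext_centroid c >]].

Lemma centroidP (c : Q) : reflect (ext_centroid c) (c \in centroid_pred).
Proof. exact: asboolP. Qed.

Lemma centroid_subring : subring_closed centroid_pred.
Proof.
split=> [|a b /centroidP ca /centroidP cb|a b /centroidP ca /centroidP cb];
  apply/centroidP => x.
- by rewrite mul1r mulr1.
- by rewrite mulrBl mulrBr ca cb.
- by rewrite -mulrA cb mulrA ca mulrA.
Qed.

HB.instance Definition _ := GRing.isSubringClosed.Build Q centroid_pred centroid_subring.

(** A type for [C], so that a field structure and the scaling of [Q] can be attached to it. *)
Record centroid := Centroid { cval : Q; _ : cval \in centroid_pred }.
HB.instance Definition _ := [isSub for cval].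
HB.instance Definition _ := [Choice of centroid by <:].
HB.instance Definition _ := [SubChoice_isSubNzRing of centroid by <:].

Lemma cvalC (c : centroid) (x : Q) : val c * x = x * val c.
Proof. by case: c => c /= /centroidP. Qed.

Lemma centroid_mulC : @commutative centroid centroid *%R.
Proof. by move=> a b; apply: val_inj; rewrite !rmorphM /= cvalC. Qed.

HB.instance Definition _ :=
  GRing.PzRing_hasCommutativeMul.Build centroid centroid_mulC.

(** Since [f x ** y = x ** f y], the map [f] can serve as both halves of one germ. The resulting
    element commutes with any [q]: with [s] in [J] and [t q] in [R], both [s t c q] and [s t q c]
    equal [f(s) t q]. *)
Lemma bimodule_centroid J (f : R -> R) : nz_ideal J ->
  (forall x y, J x -> J y -> f (x + y) = f x + f y) ->
  (forall r x, J x -> f (r ** x) = r ** f x) ->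
  (forall x r, J x -> f (x ** r) = f x ** r) ->
  exists c : centroid, forall x, J x -> Qs_of x * val c = Qs_of (f x).
Proof.
move=> nJ fD fl fr; have [[_ _ JM] _] := nJ.
have ff x y : J x -> J y -> f x ** y = x ** f y by move=> Jx Jy; rewrite -fr ?fl.
pose p := Germ nJ fD fl fD fr ff; pose c := \pi_Q p.
have cl x : J x -> Qs_of x * c = Qs_of (f x) by move=> Jx; apply: (@Qs_of_lf R p).
suff cP : c \in centroid_pred by exists (Centroid cP).
apply/centroidP => q; apply/subr0_eq; have [I nI hI] := Qs_absorb q.
apply: (Qs_faithful_l nI) => t It; apply: (Qs_faithful_l nJ) => s Js.
have [b eb] : exists b, Qs_of t * q = Qs_of b by case: (hI t It).
have [_ Jst] := JM t s Js; have [_ Jsb] := JM b s Js.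
rewrite mulrBr (mulrA (Qs_of t) q) eb mulrBr !mulrA -!Qs_ofM !cl // !fr //.
by rewrite !Qs_ofM -mulrA eb subrr.
Qed.

(** Multiplication by [c] is injective on [R], so [x c |-> x] is a well-defined bimodule map on the
    ideal [J] of those [x c] in [R] with [x] in [I]. The element of [C] representing it is the
    inverse. *)
Lemma centroid_inv (c : centroid) : c != 0 -> exists c', c' * c = 1.
Proof.
move=> c0; have vc0 : val c <> 0 by move=> e; case/eqP: c0; apply: val_inj.
have [I nI hI] := Qs_absorb (val c).
pose J : set R := [set y | exists2 x, I x & Qs_of x * val c = Qs_of y]%classic.
have [[I0 IB IM] [i Ii i0]] := nI.
have inj x : Qs_of x * val c = 0 -> x = 0.
  move=> e; case: (@Qs_prime setT (Qs_of x) (val c)) => // [|a _|/Qs_of_eq0 //].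
    exact: nz_idealT.
  by rewrite -mulrA -cvalC mulrA e mul0r.
have nJ : nz_ideal J.
  split; first split.
  - by exists 0; rewrite // Qs_of0 mul0r.
  - move=> x y [a Ia ea] [b Ib eb]; exists (a - b); first exact: IB.
    by rewrite !Qs_ofD !Qs_ofN mulrBl ea eb.
  - move=> r x [a Ia ea]; have [Ira Iar] := IM r a Ia; split.
      by exists (r ** a) => //; rewrite !Qs_ofM -mulrA ea.
    by exists (a ** r) => //; rewrite !Qs_ofM -mulrA -cvalC mulrA ea.
  have [b eb] : exists b, Qs_of i * val c = Qs_of b by case: (hI i Ii).
  by exists b => [|b0]; [exists i|apply: i0; apply: inj; rewrite eb b0].
have /choice [f fP] y : exists x, J y -> I x /\ Qs_of x * val c = Qs_of y.
  by case: (pselect (J y)) => [[x Ix e]|n]; [exists x|exists 0].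
have fE x y : J y -> Qs_of x * val c = Qs_of y -> f y = x.
  move=> Jy e; apply: subr0_eq; apply: inj.
  by have [_ e'] := fP y Jy; rewrite Qs_ofD Qs_ofN mulrBl e e' subrr.
have [[_ JB JM] _] := nJ.
have [c' c'P] : exists c' : centroid, forall x, J x -> Qs_of x * val c' = Qs_of (f x).
  apply: (@bimodule_centroid J f nJ).
  - move=> x y Jx Jy; apply: fE; first by apply: idealD => //; case: nJ.
    by rewrite !Qs_ofD mulrDl; have [_ ->] := fP x Jx; have [_ ->] := fP y Jy.
  - move=> r x Jx; apply: fE; first by case: (JM r x Jx).
    by rewrite !Qs_ofM -mulrA; have [_ ->] := fP x Jx.
  - move=> x r Jx; apply: fE; first by case: (JM r x Jx).
    by rewrite !Qs_ofM -mulrA -cvalC mulrA; have [_ ->] := fP x Jx.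
exists c'; apply: val_inj; rewrite rmorphM rmorph1; apply/subr0_eq.
apply: (Qs_faithful_l nJ) => y Jy.
by rewrite mulrBr mulrA c'P //; have [_ ->] := fP y Jy; rewrite mulr1 subrr.
Qed.

Definition cinv (c : centroid) : centroid :=
  if pselect (exists c', c' * c = 1) is left h then sval (cid h) else 0.

Lemma cinv_mulVf c : c != 0 -> cinv c * c = 1.
Proof.
move=> c0; rewrite /cinv; case: pselect => [h|[]]; last exact: centroid_inv.
by case: (cid h).
Qed.

Lemma cinv0 : cinv 0 = 0.
Proof.
rewrite /cinv; case: pselect => // -[c' c'0]; exfalso.
by move/eqP: c'0; rewrite mulr0 eq_sym oner_eq0.
Qed.

HB.instance Definition _ := GRing.ComNzRing_isField.Build centroid cinv_mulVf cinv0.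

(** * The ring Q as an algebra over the field C, and Martindale's lemma *)

Definition cscale (c : centroid) (x : Q) : Q := val c * x.

Lemma cscaleA a b x : cscale a (cscale b x) = cscale (a * b) x.
Proof. by rewrite /cscale mulrA rmorphM. Qed.
Lemma cscale1 : left_id 1 cscale.
Proof. by move=> x; rewrite /cscale rmorph1 mul1r. Qed.
Lemma cscaleDr : right_distributive cscale +%R.
Proof. by move=> a x y; apply: mulrDr. Qed.
Lemma cscaleDl x : {morph cscale^~ x : a b / a + b}.
Proof. by move=> a b; rewrite /cscale rmorphD mulrDl. Qed.

HB.instance Definition _ := GRing.Zmodule_isLmodule.Build centroid Q
  cscaleA cscale1 cscaleDr cscaleDl.

Lemma cscaleE (c : centroid) (x : Q) : c *: x = val c * x. Proof. by []. Qed.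

Lemma cscaleAl (a : centroid) (x y : Q) : a *: (x * y) = (a *: x) * y.
Proof. by rewrite !cscaleE mulrA. Qed.
HB.instance Definition _ := GRing.Lmodule_isLalgebra.Build centroid Q cscaleAl.
Lemma cscaleAr (a : centroid) (x y : Q) : a *: (x * y) = x * (a *: y).
Proof. by rewrite !cscaleE mulrA cvalC -mulrA. Qed.
HB.instance Definition _ := GRing.Lalgebra_isAlgebra.Build centroid Q cscaleAr.

Definition indep n (a : 'I_n -> Q) :=
  forall c : 'I_n -> centroid, \sum_i c i *: a i = 0 -> forall i, c i = 0.

(* The families y over R satisfying the same relation as b form a bimodule on *)
(* which, by induction, y 0 determines y, so that y 0 |-> y i is a bimodule   *)
(* map, i.e. multiplication by an element of C.                               *)
Lemma martindale n (a b : 'I_n -> Q) I : nz_ideal I -> indep a ->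
  (forall x, I x -> \sum_i a i * Qs_of x * b i = 0) -> forall i, b i = 0.
Proof.
elim: n a b I => [|n IH] a b I nI ia h; first by case.
have ia' : indep (fun i => a (lift ord0 i)).
  move=> c hc i; pose c' j := if unlift ord0 j is Some k then c k else 0.
  have := ia c' _ (lift ord0 i); rewrite /c' liftK; apply.
  rewrite big_ord_recl unlift_none scale0r add0r -[RHS]hc.
  by apply: eq_bigr => j _; rewrite liftK.
have tail (y : 'I_n.+1 -> Q) : (forall x, I x -> \sum_i a i * Qs_of x * y i = 0) ->
    y ord0 = 0 -> forall i, y i = 0.
  move=> hy y0 i; case: (unliftP ord0 i) => [j ->|-> //].
  apply: (IH (fun i => a (lift ord0 i)) (fun i => y (lift ord0 i)) I nI ia') => x Ix.
  by have := hy x Ix; rewrite big_ord_recl y0 mulr0 add0r.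
have [b0|/eqP b0] := eqVneq (b ord0) 0; first exact: tail.
(* One ideal clears the denominators of all [b i] at once: absorbing ideals are intersected along
   the list of indices. *)
have [K nK hK] : exists2 K, nz_ideal K &
    forall k, K k -> forall i, exists y, Qs_of k * b i = Qs_of y.
  suff [K nK hK] : exists2 K, nz_ideal K & forall k, K k ->
      forall i, i \in enum 'I_n.+1 -> exists y, Qs_of k * b i = Qs_of y.
    by exists K => // k Kk i; apply: hK; rewrite ?mem_enum.
  elim: (enum _) => [|i s [K nK hK]]; first by exists setT => //; apply: nz_idealT.
  have [L nL hL] := Qs_absorb (b i).
  exists (K `&` L)%classic; first exact: nz_idealI.
  move=> k [Kk Lk] j; rewrite inE => /orP [/eqP ->|]; last exact: hK.
  by case: (hL k Lk).
pose P (y : 'I_n.+1 -> R) :=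
  forall x, I x -> \sum_i a i * Qs_of x * Qs_of (y i) = 0.
have PD y z : P y -> P z -> P (fun i => y i + z i).
  move=> Py Pz x Ix; under eq_bigr do rewrite Qs_ofD mulrDr.
  by rewrite big_split /= Py // Pz // addr0.
have PN y : P y -> P (fun i => - y i).
  move=> Py x Ix; under eq_bigr do rewrite Qs_ofN mulrN.
  by rewrite sumrN Py // oppr0.
have Pr y r : P y -> P (fun i => y i ** r).
  move=> Py x Ix; under eq_bigr do rewrite Qs_ofM mulrA.
  by rewrite -mulr_suml Py // mul0r.
have Pl y r : P y -> P (fun i => r ** y i).
  move=> Py x Ix; have [[_ _ IM] _] := nI; have [_ Ixr] := IM r x Ix.
  by rewrite -[RHS](Py _ Ixr); apply: eq_bigr => i _; rewrite !Qs_ofM !mulrA.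
have P0 : P (fun=> 0).
  by move=> x Ix; rewrite big1 // => i _; rewrite Qs_of0 mulr0.
have Puniq y z : P y -> P z -> y ord0 = z ord0 -> forall i, y i = z i.
  move=> Py Pz e i; apply: subr0_eq; apply: Qs_of_eq0.
  apply: (tail (fun i => Qs_of (y i - z i))); last by rewrite e subrr Qs_of0.
  exact: (PD _ _ Py (PN _ Pz)).
have PK k (Kk : K k) y : (forall i, Qs_of k * b i = Qs_of (y i)) -> P y.
  move=> hy x Ix; have [[_ _ IM] _] := nI; have [_ Ixk] := IM k x Ix.
  rewrite -[RHS](h _ Ixk); apply: eq_bigr => i _.
  by rewrite -hy Qs_ofM !mulrA.
pose J : set R := [set u | exists2 y, P y & y ord0 = u]%classic.
have nJ : nz_ideal J.
  split; first split.
  - by exists (fun=> 0).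
  - move=> _ _ [y Py <-] [z Pz <-]; exists (fun i => y i - z i) => //.
    exact: (PD _ _ Py (PN _ Pz)).
  - move=> r _ [y Py <-]; split; first by exists (fun i => r ** y i) => //; apply: Pl.
    by exists (fun i => y i ** r) => //; apply: Pr.
  have [k Kk k0] : exists2 k, K k & Qs_of k * b ord0 <> 0.
    apply: contrapT => H; apply: b0; apply: (Qs_faithful_l nK) => k Kk.
    by apply: contrapT => n0; apply: H; exists k.
  have [y hy] := choice (hK k Kk).
  exists (y ord0); first by exists y => //; apply: (PK k).
  by move=> y0; apply: k0; rewrite hy y0.
have /choice [g gP] u : exists y, J u -> P y /\ y ord0 = u.
  by case: (pselect (J u)) => [[y Py e]|n']; [exists y|exists (fun=> 0)].
have gE u y : P y -> y ord0 = u -> forall i, g u i = y i.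
  move=> Py e; have [] := gP u; first by exists y.
  by move=> Pg ge; apply: Puniq; rewrite // ge.
have /choice [c cP] i : exists c : centroid, forall u, J u -> Qs_of u * val c = Qs_of (g u i).
  apply: (@bimodule_centroid J (fun u => g u i) nJ).
  - move=> u v Ju Jv; have [Pu eu] := gP u Ju; have [Pv ev] := gP v Jv.
    rewrite (@gE (u + v) (fun i => g u i + g v i)) //; first exact: PD.
    by rewrite eu ev.
  - move=> r u Ju; have [Pu eu] := gP u Ju.
    by rewrite (@gE (r ** u) (fun i => r ** g u i)) ?eu //; apply: Pl.
  - move=> u r Ju; have [Pu eu] := gP u Ju.
    by rewrite (@gE (u ** r) (fun i => g u i ** r)) ?eu //; apply: Pr.
have bc i : b i = c i *: b ord0.
  apply/subr0_eq; apply: (Qs_faithful_l nK) => k Kk.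
  have [y hy] := choice (hK k Kk); have Py := PK k Kk y hy.
  rewrite mulrBr -scalerAr !hy cscaleE cvalC cP; last by exists y.
  by rewrite (gE _ y) // subrr.
(* Substituting [b i = c i *: b ord0] turns the relation into [(\sum_i c i *: a i) x (b ord0) = 0]
   on [I], so primeness of [Q] applies. *)
have : \sum_i c i *: a i = 0.
  case: (@Qs_prime I (\sum_i c i *: a i) (b ord0) nI) => // x Ix.
  rewrite -[RHS](h x Ix) !mulr_suml; apply: eq_bigr => i _.
  by rewrite (bc i) -!scalerAl -scalerAr.
move/ia => c0; case: b0.
by rewrite bc c0 scale0r.
Qed.

End Centroid.

(** * Central closures of finite dimension *)

Section AddSpan.
Variables (V : zmodType) (S : set V).

Lemma add_spanN x : add_span S x -> add_span S (- x).
Proof. by move=> Sx; rewrite -sub0r; apply: add_spanB => //; apply: add_span0. Qed.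

Lemma add_spanD x y : add_span S x -> add_span S y -> add_span S (x + y).
Proof. by move=> Sx Sy; rewrite -[y]opprK; apply: add_spanB => //; apply: add_spanN. Qed.

Lemma add_span_sum (I : Type) (r : seq I) (P : pred I) (F : I -> V) :
  (forall i, P i -> add_span S (F i)) -> add_span S (\sum_(i <- r | P i) F i).
Proof. by move=> h; elim/big_rec: _ => [|i x Pi]; [apply: add_span0|apply/add_spanD/h]. Qed.

End AddSpan.

Section FiniteDim.
Variable R : primeRngType.
Local Notation Q := (Qs R).
Local Notation C := (centroid R).
Local Notation A := (@central_closure R).

Lemma central_closureZ (c : C) (x : Q) : A x -> A (c *: x).
Proof.
elim=> [_ [a [e [ce ->]]]||y z _ hy _ hz].
- apply: add_span_gen; exists a, (val c * e); split.
    by move=> y; rewrite -mulrA ce !mulrA cvalC.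
  by rewrite cscaleE mulrA cvalC -mulrA.
- by rewrite scaler0; apply: add_span0.
- by rewrite scalerBr; apply: add_spanB.
Qed.

Lemma central_closure_of (a : R) : A (Qs_of a).
Proof. by apply: add_span_gen; exists a, 1; rewrite mulr1; split=> // x; rewrite mulr1 mul1r. Qed.

Lemma central_closure_ind (P : Q -> Prop) :
  (forall (a : R) (c : C), P (c *: Qs_of a)) -> (forall x y, P x -> P y -> P (x - y)) ->
  forall x, A x -> P x.
Proof.
move=> Pg PB x; elim=> [_ [a [e [/centroidP ce ->]]]||y z _ hy _ hz].
- by have := Pg a (Centroid ce); rewrite cscaleE cvalC.
- by have := PB _ _ (Pg 0 0) (Pg 0 0); rewrite subrr.
- exact: PB.
Qed.

Lemma central_closureM (x y : Q) : A x -> A y -> A (x * y).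
Proof.
move=> Ax Ay; elim/central_closure_ind: Ax => [a c|x' x'' h' h''].
  elim/central_closure_ind: Ay => [b e|y' y'' h' h'']; last first.
    by rewrite mulrBr; apply: add_spanB.
  rewrite -scalerAl -scalerAr -Qs_ofM.
  by apply/central_closureZ/central_closureZ/central_closure_of.
by rewrite mulrBl; apply: add_spanB.
Qed.

Variables (n : nat) (v : 'I_n -> Q).
Hypothesis v_indep : indep v.
Hypothesis v_A : forall i, A (v i).
Hypothesis v_span : forall x, A x -> exists u : 'rV[C]_n, x = \sum_i u 0 i *: v i.

Let lc (u : 'rV[C]_n) : Q := \sum_i u 0 i *: v i.

Let lc_inj u : lc u = 0 -> u = 0.
Proof. by move/v_indep => h; apply/rowP => i; rewrite mxE h. Qed.

Let lcD : {morph lc : u w / u + w}.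
Proof. by move=> u w; rewrite -big_split; apply: eq_bigr => i _; rewrite mxE scalerDl. Qed.
Let lcZ c u : lc (c *: u) = c *: lc u.
Proof. by rewrite scaler_sumr; apply: eq_bigr => i _; rewrite mxE scalerA. Qed.
Let lc_sum (I : finType) (F : I -> 'rV[C]_n) : lc (\sum_i F i) = \sum_i lc (F i).
Proof.
apply: big_morph; first exact: lcD.
by rewrite /lc big1 // => i _; rewrite mxE scale0r.
Qed.

(** Sending [c] to the matrix of the map it defines is linear from n by n matrices to themselves.
    Martindale's lemma makes it injective, so by dimension it is onto. *)
Lemma multiplication_full (N : 'M[C]_n) : exists c : 'M[C]_n,
  forall u, \sum_i \sum_j c i j *: (v i * lc u * v j) = lc (u *m N).
Proof.
have /choice [T hT] (p : 'I_n * 'I_n * 'I_n) : exists u, v p.1.1 * v p.1.2 * v p.2 = lc u.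
  by apply: v_span; do !apply: central_closureM.
pose F (c : 'M[C]_n) : 'M[C]_n := \matrix_k \sum_i \sum_j c i j *: T (i, k, j).
have F_lin : linear F.
  move=> a c c'; apply/row_matrixP => k; rewrite linearP /= !rowK scaler_sumr -big_split.
  apply: eq_bigr => i _; rewrite scaler_sumr -big_split; apply: eq_bigr => j _ /=.
  by rewrite !mxE scalerDl scalerA.
pose Fl := GRing.isLinear.Build _ _ _ _ _ F_lin.
pose FL : {linear 'M[C]_n -> 'M[C]_n} := HB.pack F Fl.
have FE (c : 'M[C]_n) u : \sum_i \sum_j c i j *: (v i * lc u * v j) = lc (u *m F c).
  rewrite mulmx_sum_row lc_sum.
  transitivity (\sum_i \sum_j \sum_k c i j *: (u 0 k *: (v i * v k * v j))).
    apply: eq_bigr => i _; apply: eq_bigr => j _.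
    rewrite mulr_sumr mulr_suml scaler_sumr; apply: eq_bigr => k _.
    by rewrite -scalerAr -scalerAl.
  under eq_bigr do rewrite exchange_big /=.
  rewrite exchange_big /=; apply: eq_bigr => k _.
  rewrite lcZ rowK lc_sum scaler_sumr; apply: eq_bigr => i _.
  rewrite lc_sum scaler_sumr; apply: eq_bigr => j _.
  by rewrite lcZ -(hT (i, k, j)) /= !scalerA mulrC.
have Finj : lker (linfun FL) == 0%VS.
  apply/eqP/vspaceP => c; rewrite memv_ker memv0 lfunE /=.
  apply/eqP/eqP => [Fc0|->]; last exact: (linear0 FL).
  apply/matrixP => i j; rewrite mxE.
  suff h : \sum_j c i j *: v j = 0 by apply: (v_indep h).
  apply: (@martindale R n v (fun i => \sum_j c i j *: v j) setT (@nz_idealT R) v_indep).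
  move=> a _; have [u eu] := v_span (central_closure_of a).
  have := FE c u; rewrite Fc0 mulmx0 /lc [RHS]big1; last by move=> k _; rewrite mxE scale0r.
  rewrite -eu => e; rewrite -[RHS]e; apply: eq_bigr => k _.
  by rewrite mulr_sumr; apply: eq_bigr => l _; rewrite scalerAr.
have : N \in limg (linfun FL) by rewrite lker0_limgf // memvf.
by case/memv_imgP => c _ ->; exists c => u; rewrite lfunE FE.
Qed.

(** Otherwise 1 together with the [v i] is independent. Writing the identity map as a combination of
    the maps [x |-> v j x v k] gives a relation on [R] in which 1 is paired with the right factor
    -1, and Martindale's lemma yields -1 = 0. *)
Lemma central_closure1 : A 1.
Proof.
have [c hc] := multiplication_full 1%:M.
apply: contrapT => A1.
pose a (i : 'I_n.+1) : Q := if unlift ord0 i is Some j then v j else 1.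
pose b (i : 'I_n.+1) : Q :=
  if unlift ord0 i is Some j then \sum_k c j k *: v k else -1.
have a_indep : indep a.
  move=> e; rewrite big_ord_recl /a unlift_none; under eq_bigr do rewrite liftK.
  have [e0|e0 h] := eqVneq (e ord0) 0.
    rewrite e0 scale0r add0r => /v_indep h i.
    by case: (unliftP ord0 i) => [j ->|->].
  case: A1; have -> : 1 = - (e ord0)^-1 *: \sum_i e (lift ord0 i) *: v i :> Q.
    apply: (scalerI e0); rewrite scalerA mulrN divff // scaleN1r.
    by apply/eqP; rewrite -addr_eq0 h.
  by apply/central_closureZ/add_span_sum => i _; apply: central_closureZ.
have := martindale (I := setT) (b := b) (@nz_idealT R) a_indep.
suff h x : \sum_i a i * Qs_of x * b i = 0.
  by move/(_ (fun x _ => h x) ord0)/eqP; rewrite /b unlift_none oppr_eq0 oner_eq0.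
rewrite big_ord_recl /a /b unlift_none mul1r mulrN1.
apply/eqP; rewrite addrC subr_eq0; apply/eqP.
have [u ->] := v_span (central_closure_of x).
rewrite -[RHS]/(lc u) -[in RHS](mulmx1 u) -hc; apply: eq_bigr => i _.
by rewrite liftK mulr_sumr; apply: eq_bigr => j _; rewrite scalerAr.
Qed.

Lemma central_closure_simple z w : A z -> A w -> z <> 0 ->
  add_span [set x | exists r s, [/\ A r, A s & x = r * z * s]] w.
Proof.
move=> Az Aw z0; have [uz ez] := v_span Az; have [uw ew] := v_span Aw.
have [k uk] : exists k, uz 0 k != 0.
  apply: contrapT => /forallNP h; apply: z0.
  by rewrite ez big1 // => k _; have /negP/negPn/eqP -> := h k; rewrite scale0r.
(* This rank-one matrix takes the coordinates of [z] to those of [w]; division by the nonzero entry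
   [uz 0 k] normalizes it. *)
have [c hc] := multiplication_full ((uz 0 k)^-1 *: (delta_mx k 0 *m uw)).
have := hc uz; have -> : uz *m ((uz 0 k)^-1 *: (delta_mx k 0 *m uw)) = uw.
  apply/rowP => j; rewrite -scalemxAr mulmxA -colE mxE mxE big_ord1 !mxE.
  by rewrite mulrA mulVf // mul1r.
rewrite /lc -ez -ew => <-; apply: add_span_sum => i _; apply: add_span_sum => j _.
apply: add_span_gen; exists (c i j *: v i), (v j); rewrite -!scalerAl; split=> //.
exact: central_closureZ.
Qed.

(** By simplicity [q] is a sum of terms [r z s] with [z] in [I]; expanding [r] and [s] over [R]
    leaves scalar multiples of elements of [I]. *)
Lemma ideal_central_closure I q : nz_ideal I -> A q ->
  add_span [set x | exists a (c : C), I a /\ x = c *: Qs_of a] q.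
Proof.
move=> [[I0 IB IM] [z Iz z0]] Aq; pose S : set Q :=
  add_span [set x | exists a (c : C), I a /\ x = c *: Qs_of a]%classic.
have SZ (e : C) x : S x -> S (e *: x).
  elim=> [_ [a [f [Ia ->]]]||x' y _ hx _ hy].
  - by apply: add_span_gen; exists a, (e * f); rewrite scalerA.
  - by rewrite scaler0; apply: add_span0.
  - by rewrite scalerBr; apply: add_spanB.
have := central_closure_simple (central_closure_of z) Aq (contra_not (@Qs_of_eq0 R z) z0).
elim=> [_ [r [s [Ar As ->]]]||x y _ hx _ hy]; rewrite -/S.
- elim/central_closure_ind: Ar => [a e|x y hx hy]; last first.
    by rewrite !mulrBl; apply: add_spanB.
  elim/central_closure_ind: As => [b f|x y hx hy]; last first.
    by rewrite mulrBr; apply: add_spanB.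
  rewrite -!scalerAl -scalerAr -!Qs_ofM; apply/SZ/SZ/add_span_gen.
  by exists (a ** z ** b), 1; rewrite scale1r; split=> //; case: (IM a z Iz) => /(IM b) [].
- exact: add_span0.
- exact: add_spanB.
Qed.

(** Take an ideal [I] with [I q] inside [R]. Since 1 is a [C]-combination of elements of [I], the
    product [1 * q] is a [C]-combination of elements of [R]. *)
Lemma central_closureT q : A q.
Proof.
have [I nI hI] := Qs_absorb q.
rewrite -[q]mul1r; elim: (ideal_central_closure nI central_closure1).
- move=> _ [a [c [Ia ->]]]; have [b eb] : exists b, Qs_of a * q = Qs_of b.
    by case: (hI a Ia).
  by rewrite -scalerAl eb; apply/central_closureZ/central_closure_of.
- by rewrite mul0r; apply: add_span0.
- by move=> x y _ hx _ hy; rewrite mulrBl; apply: add_spanB.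
Qed.

End FiniteDim.

(** * Quaternion algebras in characteristic two *)

Section Bracket.
Variables (F : fieldType) (A : algType F).
Hypothesis A2 : forall x : A, x + x = 0.
Implicit Types x y z : A.

(* The commutator: 2A = 0 throughout. *)
Definition br x y := x * y + y * x.

Lemma oppr_char2 x : - x = x.
Proof. by apply: (addrI x); rewrite subrr A2. Qed.

Lemma addr_eq0_char2 x y : (x + y = 0) -> x = y.
Proof. by move=> /eqP; rewrite addr_eq0 oppr_char2 => /eqP. Qed.

Lemma brE x y : x * y - y * x = br x y. Proof. by rewrite oppr_char2. Qed.
Lemma brC x y : br x y = br y x. Proof. exact: addrC. Qed.
Lemma brxx x : br x x = 0. Proof. exact: A2. Qed.
Lemma brDr x y z : br x (y + z) = br x y + br x z.
Proof. by rewrite /br mulrDl mulrDr addrACA. Qed.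
Lemma brDl x y z : br (x + y) z = br x z + br y z.
Proof. by rewrite brC brDr !(brC z). Qed.
Lemma brZr a x y : br x (a *: y) = a *: br x y.
Proof. by rewrite /br -scalerAl -scalerAr scalerDr. Qed.
Lemma brZl a x y : br (a *: x) y = a *: br x y.
Proof. by rewrite brC brZr brC. Qed.
Lemma brMr x y z : br x (y * z) = br x y * z + y * br x z.
Proof. by rewrite /br mulrDl mulrDr !mulrA -addrA (addrA (y * x * z)) A2 add0r. Qed.
Lemma brAr x a : br x a%:A = 0.
Proof. by rewrite brZr /br mulr1 mul1r A2 scaler0. Qed.
Lemma brAl x a : br a%:A x = 0. Proof. by rewrite brC brAr. Qed.
Lemma br_eq0 x y : br x y = 0 <-> x * y = y * x.
Proof. by split=> [/addr_eq0_char2 //|e]; rewrite /br e A2. Qed.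
Lemma brsq x y : br (x * x) y = br x (br x y).
Proof.
by rewrite /br mulrDr mulrDl !mulrA -[RHS]addrA (addrA (x * y * x)) A2 add0r.
Qed.

Definition scal x := exists a : F, x = a%:A.
End Bracket.

(** * Centralizers in a simple algebra of dimension four *)

Section Centralizer.
Variables (F : fieldType) (A : falgType F).
Hypothesis A2 : forall x : A, x + x = 0.
Hypothesis dimA : \dim {:A} = 4%N.
Hypothesis simpleA : forall z w : A, z <> 0 ->
  add_span [set x | exists r s, x = r * z * s]%classic w.
Implicit Types x y z : A.

(* If the centralizer K of x had dimension 3, then [x,A] would be a line Ce,   *)
(* Ke and eK would lie in Ce, and some k <> 0 in K would satisfy ke = ek = 0; *)
(* but then x commutes with all rks, hence with all of A.                     *)
Lemma centralizer_dim2 x y z : br x z <> 0 -> br x y = 0 ->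
  exists a b : F, y = a%:A + b *: x.
Proof.
move=> xz xy; apply: contrapT => ny.
pose f : 'End(A) := (amull x + amulr x)%VF; set e := br x z.
have fE w : f w = br x w by rewrite !lfunE /= !lfunE.
have fr : free [:: y; x; 1].
  rewrite 2!free_cons seq1_free oner_eq0 andbT span_seq1.
  apply/andP; split.
    rewrite span_cons span_seq1; apply/memv_addP => -[_ /vlineP [b ->] [_ /vlineP [a ->]]].
    by rewrite addrC => E; apply: ny; exists a, b.
  by apply/negP => /vlineP [a E]; apply: xz; rewrite E brAl.
pose K := lker f; have Kdim : (3 <= \dim K)%N.
  have <- : \dim <<[:: y; x; 1]>> = 3%N by apply/eqP; rewrite -/(free _).
  apply: dimvS; apply/span_subvP => w; rewrite !inE memv_ker fE.
  case/or3P => /eqP ->; [exact/eqP|by rewrite brxx|].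
  by have := brAr A2 x 1; rewrite scale1r => ->.
have fim w : exists a, br x w = a *: e.
  apply/vlineP; rewrite -fE; suff -> : <[e]>%VS = limg f by apply: memv_img; apply: memvf.
  apply/eqP; rewrite eqEdim; apply/andP; split.
    by rewrite -memvE /e -fE; apply: memv_img; apply: memvf.
  have := limg_ker_dim f fullv; rewrite dimA capfv -/K dim_vline.
  have -> : e != 0 by exact/eqP.
  by move: (\dim K) (\dim (limg f)) Kdim; lia.
(* Rank-nullity: a map from [U] into the line spanned by [e] lowers the dimension by at most one on
   passing to its kernel. *)
have f_line (w : A -> A) (U : {vspace A}) : (forall k, k \in U -> w k \in <[e]>%VS) ->
    forall g : 'End(A), (forall k, g k = w k) ->
    (\dim U <= (\dim (U :&: lker g)).+1)%N.
  move=> h g gE; rewrite -(limg_ker_dim g U) -addn1 leq_add2l.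
  apply: (@leq_trans (\dim <[e]>)); last by rewrite dim_vline leq_b1.
  by apply: dimvS; apply/subvP => _ /memv_imgP [k Uk ->]; rewrite gE h.
have Kbr k : k \in K -> br x k = 0 by rewrite memv_ker fE => /eqP.
pose K1 := (K :&: lker (amulr e))%VS; pose K2 := (K1 :&: lker (amull e))%VS.
have dK1 : (\dim K <= (\dim K1).+1)%N.
  (* As [k] commutes with [x], [k * e] is the bracket of [x] with [k * z] and hence lies on the
     line. *)
  apply: (f_line (fun k => k * e)) => [k /Kbr xk|k]; last by rewrite lfunE.
  by have [a ea] := fim (k * z); apply/vlineP; exists a; rewrite -ea brMr // xk mul0r add0r.
have dK2 : (\dim K1 <= (\dim K2).+1)%N.
  apply: (f_line (fun k => e * k)) => [k|k]; last by rewrite lfunE.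
  rewrite memv_cap => /andP [/Kbr xk _].
  by have [a ea] := fim (z * k); apply/vlineP; exists a; rewrite -ea brMr // xk mulr0 addr0.
have : K2 != 0%VS by rewrite -dimv_eq0; move: (\dim K) (\dim K1) (\dim K2) Kdim dK1 dK2; lia.
rewrite -vpick0; set k := vpick K2 => /eqP k0.
have := memv_pick K2; rewrite -/k !memv_cap -andbA => /and3P [/Kbr xk].
rewrite !memv_ker !lfunE /= => /eqP ke /eqP ek.
apply: xz; elim: (simpleA z k0) => [_ [r [s ->]]||y1 y2 _ h1 _ h2].
- have [a ea] := fim r; have [b eb] := fim s.
  rewrite brMr // brMr // xk mulr0 addr0 ea eb -scalerAl -!scalerAr -!scalerAl.
  by rewrite ek -mulrA ke mulr0 mul0r !scaler0 addr0.
- by rewrite /br mulr0 mul0r addr0.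
- by rewrite oppr_char2 // brDr h1 h2 addr0.
Qed.
End Centralizer.

(** * Artin-Schreier coordinates in characteristic two *)

Section Quaternion.
Variables (F : fieldType) (A : algType F).
Hypothesis A2 : forall x : A, x + x = 0.
Hypothesis centerA : forall x : A, (forall y, br x y = 0) -> scal x.
Implicit Types x y z u w : A.

Lemma scalD x y : scal x -> scal y -> scal (x + y).
Proof. by move=> [a ->] [b ->]; exists (a + b); rewrite scalerDl. Qed.

Lemma scalZ (a : F) x : scal x -> scal (a *: x).
Proof. by move=> [b ->]; exists (a * b); rewrite scalerA. Qed.

Lemma scalDl x y : scal x -> scal (x + y) -> scal y.
Proof. by move=> sx sxy; have := scalD sx sxy; rewrite addrA A2 add0r. Qed.

(** If [br x y = a%:A] with [a] nonzero, then [br x (x * y) = a *: x] is scalar too, so [x] is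
    scalar after all. *)
Lemma scal_br x : (forall y, scal (br x y)) -> scal x.
Proof.
move=> h; apply: contrapT => nx; apply: (nx); apply: centerA => y.
have [a ea] := h y; apply: contrapT; rewrite ea => /eqP a0; apply: nx.
have a1 : a != 0 by apply: contra_neq a0 => ->; rewrite scale0r.
have := h (x * y); rewrite brMr // brxx // mul0r add0r ea -scalerAr mulr1.
by move/(scalZ a^-1); rewrite scalerA mulVf // scale1r.
Qed.

Lemma br_scal x y : scal x -> br x y = 0.
Proof. by move=> [a ->]; rewrite brAl. Qed.

Hypothesis centralizerA : forall x y z, br x z <> 0 -> br x y = 0 ->
  exists a b : F, y = a%:A + b *: x.
Hypothesis simpleA : forall z w : A, z <> 0 ->
  add_span [set x | exists r s, x = r * z * s]%classic w.
Hypothesis noncommA : exists x y : A, br x y <> 0.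

(** A noncentral [y] satisfies [y * y = a%:A + b *: y], and when [b] is nonzero [b^-1 *: y] is a
    solution. If [b] were always zero, every square would be scalar; polarizing makes every
    commutator scalar, so the algebra would be commutative. *)
Lemma exists_artin_schreier : exists x n, x * x = x + n%:A /\ exists z, br x z <> 0.
Proof.
apply: contrapT => H.
have sq y : scal (y * y).
  have [sy|ny] := pselect (scal y).
    by case: sy => a ->; rewrite -scalerAl mul1r; apply: scalZ; exists a.
  have [z yz] : exists z, br y z <> 0.
    by apply/existsNP => h; apply: ny; apply: centerA.
  have [|a [b e]] := centralizerA (y := y * y) yz.
    by rewrite brMr // brxx // mul0r mulr0 addr0.
  have [b0|b0] := eqVneq b 0; first by exists a; rewrite e b0 scale0r addr0.
  case: H; exists (b^-1 *: y), (b^-1 * b^-1 * a); split.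
    rewrite -scalerAl -scalerAr e !scalerDr !scalerA addrC.
    by congr (_ + _); rewrite -mulrA mulVf // mulr1.
  exists z; rewrite brZl => /eqP; rewrite scaler_eq0 invr_eq0 (negPf b0) /=.
  by move/eqP.
case: noncommA => y [z]; apply; apply: br_scal; apply: scal_br => {}z.
apply: (scalDl (sq y)); apply: (scalDl (sq z)).
suff -> : z * z + (y * y + br y z) = (y + z) * (y + z) by [].
by rewrite /br mulrDl !mulrDr addrC -!addrA.
Qed.

Variables (x : A) (n : F).
Hypothesis xx : x * x = x + n%:A.
Hypothesis x_noncentral : exists z, br x z <> 0.

Let W w := br x w = w.

Let W_br y : W (br x y).
Proof. by rewrite /W -brsq // xx brDl brAl // addr0. Qed.

(** From [x * x = x + n%:A], bracketing with [x] is idempotent. Hence [w = br x y] lies in [W], and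
    [y + w] commutes with [x]. *)
Lemma artin_schreier_decomp y : exists a b w, W w /\ y = a%:A + b *: x + w.
Proof.
have [z xz] := x_noncentral.
have [|a [b e]] := centralizerA (y := y + br x y) xz; first by rewrite brDr W_br A2.
by exists a, b, (br x y); rewrite -e -addrA A2 addr0.
Qed.

Let WD u w : W u -> W w -> W (u + w).
Proof. by rewrite /W brDr => -> ->. Qed.
Let WZ (a : F) w : W w -> W (a *: w).
Proof. by rewrite /W brZr => ->. Qed.

(** The square commutes with [x], so it is [a%:A + b *: x]; it also commutes with [w], which forces
    [b *: w = 0]. *)
Lemma artin_schreier_sq w : W w -> scal (w * w).
Proof.
move=> Ww; have [z xz] := x_noncentral.
have [|a [b e]] := centralizerA (y := w * w) xz.
  by rewrite brMr // Ww A2.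
have : br w (w * w) = 0 by rewrite brMr // brxx // mul0r mulr0 addr0.
rewrite e brDr brAr // add0r brZr brC Ww => /eqP; rewrite scaler_eq0.
case/orP => /eqP e0; first by exists a; rewrite e0 scale0r addr0.
by rewrite -e e0 mulr0; exists 0; rewrite scale0r.
Qed.

(** If all squares on [W] vanished, elements of [W] would commute with each other by polarization,
    and [w * x = x * w + w] would give [w * r * w = 0] for every [r]. Simplicity then kills [W],
    although [br x z] is a nonzero member of it. *)
Lemma artin_schreier_anisotropic : exists w m, [/\ W w, m != 0 & w * w = m%:A].
Proof.
apply: contrapT => H.
have sq0 w : W w -> w * w = 0.
  move=> Ww; have [m e] := artin_schreier_sq Ww; have [m0|m0] := eqVneq m 0.
    by rewrite e m0 scale0r.
  by case: H; exists w, m.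
have W0 w : W w -> w = 0.
  move=> Ww; apply: contrapT => w0.
  have wrw r : w * r * w = 0.
    have [a [b [u [Wu ->]]]] := artin_schreier_decomp r.
    rewrite !mulrDr !mulrDl -!scalerAr mulr1 -!scalerAl sq0 // scaler0 add0r.
    have -> : w * x = x * w + w.
      by apply: addr_eq0_char2 => //; rewrite addrA (addrC (w * x)) -/(br x w) Ww A2.
    have /addr_eq0_char2 -> // : w * u + u * w = 0.
      have := sq0 _ (WD Ww Wu); rewrite mulrDl !mulrDr !sq0 // add0r addr0.
      by [].
    rewrite mulrDl -!mulrA !sq0 // !mulr0. by rewrite !addr0 scaler0.
  suff : w * 1 = 0 by rewrite mulr1.
  elim: (simpleA 1 w0) => [_ [r [s ->]]||y1 y2 _ h1 _ h2].
  - by rewrite !mulrA wrw mul0r.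
  - by rewrite mulr0.
  - by rewrite mulrBr h1 h2 subrr.
by have [z []] := x_noncentral; apply: W0.
Qed.

Let W_scal w : W w -> scal w -> w = 0.
Proof. by move=> Ww [a e]; rewrite -Ww e brAr. Qed.

Lemma scal_br_W u w : W u -> W w -> scal (br u w).
Proof.
move=> Wu Ww; apply: (scalDl (artin_schreier_sq Wu)).
apply: (scalDl (artin_schreier_sq Ww)).
suff -> : w * w + (u * u + br u w) = (u + w) * (u + w).
  exact/artin_schreier_sq/WD.
by rewrite /br mulrDl !mulrDr addrC -!addrA.
Qed.

Let scal_brW u y a : W u -> (exists w, W w /\ scal (y + w)) -> scal (br (a%:A + u) y).
Proof.
move=> Wu [w [Ww [c e]]]; have -> : y = w + c%:A.
  by rewrite -e addrCA A2 addr0.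
by rewrite brDl brAl // add0r brDr brAr // addr0; apply: scal_br_W.
Qed.

Let br_decomp y z : exists w, W w /\ scal (br y z + w).
Proof.
have [a [b [u [Wu ->]]]] := artin_schreier_decomp y.
have [c [d [w [Ww ->]]]] := artin_schreier_decomp z.
exists (b *: w + d *: u); split; first by apply: WD; apply: WZ.
rewrite !brDl !brDr !brAl // !brAr // !add0r !brZl !brZr brxx // !scaler0 add0r Ww.
rewrite (brC u x) Wu; have := scal_br_W Wu Ww; set s := br u w.
by rewrite (addrA (b *: w)) (addrC _ s) -addrA A2 addr0.
Qed.

(** Every commutator lies in [C + W], and two elements of [W] have a scalar bracket. *)
Lemma scal_br_br y z y' z' : scal (br (br y z) (br y' z')).
Proof.
have [w [Ww [a e]]] := br_decomp y z.
have -> : br y z = a%:A + w by rewrite -e -addrA A2 addr0.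
exact: scal_brW.
Qed.

Lemma br_br_neq0 : exists y z y' z', br (br y z) (br y' z') <> 0.
Proof.
have [w [m [Ww m0 ww]]] := artin_schreier_anisotropic.
(* The inner brackets are [w] and [x * w], and [br w (x * w) = w * w = m%:A]. *)
exists x, w, x, (x * w); rewrite brMr // brxx // mul0r add0r Ww.
rewrite brMr // brxx // mulr0 addr0 brC Ww ww => /eqP.
by rewrite scaler_eq0 oner_eq0 orbF (negPf m0).
Qed.

(** Let [al], [be] be the [x]-coordinates and [w], [u] the [W]-parts of [a], [b]. Testing at [x]
    gives [be *: w = 0], and testing on [W] gives [al * be = 0]. So either [b] lies in [C + W], or
    [a] is scalar. *)
Lemma scal_br_comp a b : (forall y, scal (br b (br a y))) ->
  scal a \/ forall y z, scal (br b (br y z)).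
Proof.
have [c [al [w [Ww ->]]]] := artin_schreier_decomp a.
have [c' [be [u [Wu ->]]]] := artin_schreier_decomp b.
have brW v : W v -> br (c'%:A + be *: x + u) v = be *: v + br u v.
  by move=> Wv; rewrite !brDl brAl // add0r brZl Wv.
move=> h.
have bw : be *: w = 0.
  apply: W_scal; first exact: WZ.
  have := h x; rewrite !(brDl _ _ x) brAl // add0r brZl brxx // scaler0 add0r (brC w) Ww brW // addrC.
  by apply: scalDl; apply: scal_br_W.
have ab v : W v -> (al * be) *: v = 0.
  move=> Wv; apply: W_scal; first exact: WZ.
  have := h v; rewrite !(brDl _ _ v) brAl // add0r brZl Wv.
  have [s es] := scal_br_W Ww Wv; rewrite brDr es brAr // addr0 brZr brW // scalerDr scalerA addrC.
  by apply: scalDl; apply/scalZ/scal_br_W.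
have [b0|b0] := eqVneq be 0.
  right=> y z; rewrite b0 scale0r addr0; apply: scal_brW => //.
left; move/eqP: bw; rewrite scaler_eq0 (negPf b0) /= => /eqP ->.
have [v [m [Wv m0 vv]]] := artin_schreier_anisotropic.
move/eqP: (ab v Wv); rewrite scaler_eq0 mulf_eq0 (negPf b0) orbF => /orP [/eqP ->|/eqP v0].
  by exists c; rewrite scale0r !addr0.
by move/eqP: vv; rewrite v0 mul0r eq_sym scaler_eq0 oner_eq0 orbF (negPf m0).
Qed.

(** With [u] the [W]-part of [e], testing at [x] makes [u + l *: x] scalar; bracketing with [x]
    kills [u], and [x] is not scalar, so [l = 0]. *)
Lemma scal_br_scale e (l : F) : (forall y, scal (br e y + l *: y)) -> scal e /\ l = 0.
Proof.
move=> h; suff l0 : l = 0.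
  by split=> //; apply: scal_br => y; have := h y; rewrite l0 scale0r addr0.
have [c [be [u [Wu eu]]]] := artin_schreier_decomp e.
have [m em] : scal (u + l *: x).
  by have := h x; rewrite eu !brDl brAl // add0r brZl brxx // scaler0 add0r brC Wu.
have u0 : u = 0.
  by have := brAr A2 x m; rewrite -em brDr brZr brxx // scaler0 addr0 Wu.
apply/eqP; apply/negPn/negP => l0; have [z []] := x_noncentral; apply: br_scal.
exists (l^-1 * m); rewrite -scalerA -em u0 add0r scalerA mulVf // scale1r.
by [].
Qed.

(* D x lies in W, so D + [D x, -] kills x; as W = (C + Cx)w0, this derivation  *)
(* maps w0 to a multiple a w0 and equals [ax, -].                             *)
Lemma linear_derivation_inner (D : A -> A) :
  is_derivation *%R D -> (forall (c : F) y, D (c *: y) = c *: D y) ->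
  exists a, forall y, D y = br a y.
Proof.
have D1_0 E : is_derivation *%R E -> E 1 = 0 :> A.
  by move=> [ED EM]; have := EM 1 1; rewrite !mul1r mulr1 A2.
have br_der a : is_derivation *%R (br a : A -> A).
  by split=> [y z|y z]; rewrite ?brDr // brMr // addrC.
have add_der E E' : is_derivation *%R E -> is_derivation *%R E' ->
    is_derivation *%R (fun y : A => E y + E' y).
  move=> [ED EM] [ED' EM']; split=> [y z|y z]; first by rewrite ED ED' addrACA.
  by rewrite EM EM' mulrDr mulrDl addrACA.
have [w0 [m [Ww0 m0 ww0]]] := artin_schreier_anisotropic.
(* The product [w * w0] commutes with [x], hence lies in [C + Cx]; multiply on the right by [w0] and
   divide by [m]. *)
have Wgen w : W w -> exists a b, w = a *: w0 + b *: (x * w0).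
  move=> Ww; have [z xz] := x_noncentral.
  have [|a [b e]] := centralizerA (y := w * w0) xz; first by rewrite brMr // Ww Ww0 A2.
  exists (m^-1 * a), (m^-1 * b); rewrite -!scalerA -scalerDr -[a *: w0]mul1r.
  rewrite -scalerAr scalerAl scalerAl -mulrDl -e -mulrA ww0 -scalerAr mulr1.
  by rewrite scalerA mulVf // scale1r.
move=> Dder DZ; have [DD DM] := Dder.
(* Differentiate [x * x = x + n%:A]. *)
have WDx : W (D x).
  have := DM x x; rewrite xx DD DZ D1_0 // scaler0 addr0 => e.
  by rewrite /W /br -e.
pose D1 y := D y + br (D x) y.
have D1der : is_derivation *%R D1 by exact: add_der.
have [D1D D1M] := D1der.
have D1Z (c : F) y : D1 (c *: y) = c *: D1 y. by rewrite /D1 DZ brZr [RHS]scalerDr.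
have D1x : D1 x = 0 by rewrite /D1 brC WDx A2.
have WD1 w : W w -> W (D1 w).
  by move=> Ww; rewrite /W -{2}Ww /br D1D !D1M D1x mul0r mulr0 addr0 add0r.
have [a [b e]] := Wgen _ (WD1 _ Ww0).
(* Differentiating [w0 * w0 = m%:A] gives [b * m = 0]. *)
have b0 : b = 0.
  have : D1 (w0 * w0) = 0 by rewrite ww0 D1Z D1_0 // scaler0.
  rewrite D1M -/(br w0 (D1 w0)) e brDr !brZr brxx // scaler0 add0r.
  rewrite brMr // brxx // mulr0 addr0 brC Ww0 ww0 scalerA => /eqP.
  by rewrite scaler_eq0 oner_eq0 orbF mulf_eq0 (negPf m0) orbF => /eqP.
pose D2 y := D1 y + br (a *: x) y.
have D2der : is_derivation *%R D2 by exact: add_der.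
have [D2D D2M] := D2der.
have D2Z (c : F) y : D2 (c *: y) = c *: D2 y by rewrite /D2 D1Z brZr [RHS]scalerDr.
have D2x : D2 x = 0 by rewrite /D2 D1x brZl brxx // scaler0 addr0.
have D2w0 : D2 w0 = 0 by rewrite /D2 e b0 scale0r addr0 brZl Ww0 A2.
exists (D x + a *: x) => y; apply: addr_eq0_char2 => //; rewrite brDl addrA -/(D1 y) -/(D2 y).
have [c [d [w [Ww ->]]]] := artin_schreier_decomp y.
have [f [g ->]] := Wgen _ Ww.
by rewrite !D2D !D2Z D2M D2x D2w0 mulr0 mul0r D1_0 // !(addr0, scaler0).
Qed.

End Quaternion.

(** * The quotient ring of an exceptional ring *)

Section Exceptional.
Variable R : primeRngType.
Hypothesis exR : exceptional R.
Local Notation Q := (Qs R).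
Local Notation C := (centroid R).

Lemma exceptional_addxx (x : Q) : x + x = 0.
Proof.
have [char2 _] := exR; apply: (Qs_faithful_l (@nz_idealT R)) => a _.
by rewrite mulrDr -mulrDl -Qs_ofD -mulr2n char2 Qs_of0 mul0r.
Qed.

Lemma exceptional_basis : exists v : 'I_4 -> Q, [/\ indep v,
  forall i, central_closure (v i) &
  forall x, central_closure x -> exists u : 'rV[C]_4, x = \sum_i u 0 i *: v i].
Proof.
have [_ [v [vA v_ind v_span]]] := exR; exists v; split=> // [c hc i|x /v_span [c cC ->]].
  apply: val_inj; apply: (v_ind (fun i => val (c i))) => // j.
  by apply/centroidP; case: (c j).
have cP i : c i \in @centroid_pred R by apply/centroidP/cC.
by exists (\row_i Centroid (cP i)); apply: eq_bigr => i _; rewrite mxE.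
Qed.

Lemma centroid_scal (x : Q) : ext_centroid x <-> scal x.
Proof.
split=> [/centroidP cx|[c ->] y].
  by exists (Centroid cx); rewrite cscaleE mulr1.
by rewrite -scalerAl -scalerAr mul1r mulr1.
Qed.

Lemma exceptional_center (x : Q) : (forall y, br x y = 0) -> scal x.
Proof.
move=> h; apply/centroid_scal => y.
by apply/br_eq0 => //; exact: exceptional_addxx.
Qed.

Lemma exceptional_closureT (x : Q) : central_closure x.
Proof. by have [v [iv vA vs]] := exceptional_basis; apply: (central_closureT iv). Qed.

Lemma exceptional_simple (z w : Q) : z <> 0 ->
  add_span [set x | exists r s, x = r * z * s]%classic w.
Proof.
have [v [iv vA vs]] := exceptional_basis => z0.
have := central_closure_simple iv vA vs (exceptional_closureT z) (exceptional_closureT w) z0.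
elim=> [_ [r [s [_ _ ->]]]||x y _ hx _ hy].
- by apply: add_span_gen; exists r, s.
- exact: add_span0.
- exact: add_spanB.
Qed.

Lemma exceptional_ideal_span I q : nz_ideal I ->
  add_span [set x | exists a (c : C), I a /\ x = c *: Qs_of a]%classic q.
Proof.
move=> nI; have [v [iv vA vs]] := exceptional_basis.
exact: (ideal_central_closure iv vA vs nI (exceptional_closureT q)).
Qed.

(** If [Q] were commutative, the basis vectors [v 0] and [v 1] would be scalars [c0] and [c1],
    dependent through [c1 *: v 0 - c0 *: v 1 = 0]. *)
Lemma exceptional_noncomm : exists x y : Q, br x y <> 0.
Proof.
apply: contrapT => h; have [v [iv _ _]] := exceptional_basis.
have {h} sc (x : Q) : scal x.
  by apply: exceptional_center => y; apply: contrapT => xy; apply: h; exists x, y.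
have [c0 e0] := sc (v 0); have [c1 e1] := sc (v 1).
pose c (i : 'I_4) := if i == 0 then c1 else if i == 1 then - c0 else 0.
have hc : \sum_i c i *: v i = 0.
  rewrite !big_ord_recl big_ord0 /c /= !addr0.
  rewrite (_ : lift ord0 ord0 = 1); last exact: val_inj.
  by rewrite e0 e1 !scale0r !addr0 !scalerA mulNr scaleNr mulrC subrr.
have c10 : c1 = 0 by have := iv c hc 0.
pose d (i : 'I_4) : C := if i == 1 then 1 else 0.
have hd : \sum_i d i *: v i = 0.
  rewrite (bigD1 1) //= /d eqxx e1 c10 !scale0r scaler0 add0r big1 // => i i1.
  by rewrite (negPf i1) scale0r.
by have := iv d hd 1; rewrite /d eqxx => /eqP; rewrite oner_eq0.
Qed.

Lemma exceptional_centralizer (x y z : Q) : br x z <> 0 -> br x y = 0 ->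
  exists a b : C, y = a%:A + b *: x.
Proof.
have [v [iv vA vs]] := exceptional_basis.
pose lc (u : 'rV[C]_4) : Q := \sum_i u 0 i *: v i.
have lc_lin : linear lc.
  move=> c u w; rewrite /lc scaler_sumr -big_split; apply: eq_bigr => i _.
  by rewrite !mxE scalerDl scalerA.
pose lcL : {linear 'rV[C]_4 -> Q} := HB.pack lc (GRing.isLinear.Build _ _ _ _ _ lc_lin).
have lc_inj : injective lc.
  move=> u w e; apply/subr0_eq/rowP => i; rewrite [RHS]mxE.
  by have /iv/(_ i) : lc (u - w) = 0 by rewrite -[lc]/(lcL : _ -> _) linearB /= e subrr.
have /choice [co coE] q : exists u, q = lc u := vs q (exceptional_closureT q).
have co_lin : linear co.
  by move=> c p q; apply: lc_inj; rewrite lc_lin -!coE.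
(* Coordinates in the chosen basis make [Q] a four-dimensional algebra object, to which the
   dimension count for centralizers applies. *)
have ax : Vector.axiom 4 Q.
  exists co => //; exists lc => [q|u]; first by rewrite -coE.
  by apply: lc_inj; rewrite -coE.
pose V : vectType C := HB.pack Q (Lmodule_hasFinDim.Build C Q ax).
pose A : falgType C := HB.pack Q V (Algebra_isFalgebra.Build C V).
have dimA : \dim {:A} = 4%N by rewrite dimvf.
exact: (@centralizer_dim2 C A exceptional_addxx dimA exceptional_simple x y z).
Qed.
End Exceptional.

(** * Extension of derivations *)

Section Extension.
Variables (R : primeRngType) (d : R -> R).
Hypothesis der_d : is_derivation (@rng_mul R) d.
Local Notation Q := (Qs R).
Implicit Types (p q : germ R) (x y r : R).

Let dD x y : d (x + y) = d x + d y. Proof. by case: der_d. Qed.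
Let dM x y : d (x ** y) = x ** d y + d x ** y. Proof. by case: der_d. Qed.
Let d0 : d 0 = 0. Proof. by apply: (addrI (d 0)); rewrite -dD !addr0. Qed.
Let dN x : d (- x) = - d x. Proof. by apply: (addrI (d x)); rewrite -dD !subrr. Qed.

(** Where the derivative of a germ is computable: its formula evaluates the germ at both [x] and
    [d x]. By the Leibniz rule it contains all products of two elements of [I]. *)
Definition der_ideal (I : set R) : set R := [set x | I x /\ I (d x)].

Lemma der_ideal_nz I : nz_ideal I -> nz_ideal (der_ideal I).
Proof.
move=> [II [a Ia a0]]; have [I0 IB IM] := II.
have Il r x : I x -> I (r ** x) by case/(IM r).
have Ir r x : I x -> I (x ** r) by case/(IM r).
have ID x y : I x -> I y -> I (x + y) by apply: idealD.
split; first split.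
- by split; rewrite ?d0.
- by move=> x y [Ix Idx] [Iy Idy]; split; rewrite ?dD ?dN; apply: IB.
- by move=> r x [Ix Idx]; split; split; rewrite ?dM; auto.
have [r rP] : exists r, a ** r ** a <> 0.
  by apply/existsNP => h; case: (@prime_rngP R _ _ h).
by exists (a ** r ** a) => //; split; rewrite ?dM; auto.
Qed.

(* The values x(dq) = d(xq) - (dx)q and (dq)x = d(qx) - q(dx) are forced by    *)
(* the Leibniz rule.                                                          *)
Program Definition germ_der p : germ R :=
  @Germ R (der_ideal (dom p)) (fun x => d (lf p x) - lf p (d x))
    (fun x => d (rf p x) - rf p (d x)) (der_ideal_nz (dom_nz p)) _ _ _ _ _.
Next Obligation. by case: H => ? ?; case: H0 => ? ?; rewrite dD !lfD // dD opprD addrACA. Qed.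
Next Obligation.
case: H => px pdx; rewrite dM lfM // lfD ?lfM // ?dM; [|exact: domMl|exact: domMl].
by rewrite rng_mulDr rng_mulNr opprD addrACA subrr addr0.
Qed.
Next Obligation. by case: H => ? ?; case: H0 => ? ?; rewrite dD !rfD // dD opprD addrACA. Qed.
Next Obligation.
case: H => px pdx; rewrite dM rfM // rfD ?rfM // ?dM; [|exact: domMr|exact: domMr].
by rewrite rng_mulDl rng_mulNl opprD addrACA subrr add0r.
Qed.
Next Obligation.
case: H => px pdx; case: H0 => py pdy.
rewrite rng_mulDl rng_mulDr rng_mulNl rng_mulNr (lrf pdx py) -(lrf px pdy).
have e : lf p x ** d y + d (lf p x) ** y = x ** d (rf p y) + d x ** rf p y.
  by rewrite -!dM lrf.
by apply: (addrI (lf p x ** d y)); rewrite addrA e addrK [RHS]addrC subrK.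
Qed.

Lemma germ_der_eq p q : germ_eq p q -> germ_eq (germ_der p) (germ_der q).
Proof.
case=> I nI h; exists (der_ideal I); first exact: der_ideal_nz.
move=> x [/h [px qx epl epr] /h [pdx qdx edl edr]].
by split; [split|split|rewrite /= epl edl|rewrite /= epr edr].
Qed.

Definition Qs_der (x : Q) : Q := \pi_Q (germ_der (repr x)).

Lemma pi_Qs_der p : Qs_der (\pi_Q p) = \pi_Q (germ_der p).
Proof. by apply/Qs_eqP/germ_der_eq; apply: germ_eq_repr. Qed.

Lemma Qs_der_extends : extends_to_Qs d Qs_der.
Proof.
split=> [|a]; last first.
  rewrite pi_Qs_der; apply/Qs_eqP/germ_eqP => x _ _ /=.
  by rewrite !dM addrK [_ + d a ** x]addrC addrK.
have piD p q : \pi_Q p + \pi_Q q = \pi_Q (germ_add p q) := pi_Qs_add p q.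
have piM p q : \pi_Q p * \pi_Q q = \pi_Q (germ_mul p q) := pi_Qs_mul p q.
split; elim/quotW=> p; elim/quotW=> q.
  rewrite (pi_Qs_der p) (pi_Qs_der q) !piD pi_Qs_der.
  by apply/Qs_eqP/germ_eqP => x _ _ /=; rewrite !dD !opprD; split; apply: addrACA.
rewrite (pi_Qs_der p) (pi_Qs_der q) !piM pi_Qs_der piD.
apply/Qs_eqP/germ_eqP => x /= [[px qx [qlx _] [prx _]] [pdx qdx [qldx _] [prdx _]]].
move=> [[_ _ [[_ qdlx] _] _] [_ _ _ [[_ pdrx] _]]]; split.
  by rewrite lfD ?lfN //; [rewrite addrA subrK|apply: domN].
rewrite rfD ?rfN //; last exact: domN.
by rewrite [RHS]addrC addrA subrK.
Qed.

End Extension.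

(** * Derivations of exceptional rings *)

Section ExceptionalDerivations.
Variable R : primeRngType.
Hypothesis exR : exceptional R.
Local Notation Q := (Qs R).
Local Notation C := (centroid R).

Let Q2 := exceptional_addxx exR.

Lemma exceptional_scal_br (a : Q) : (forall y, scal (br a y)) -> scal a.
Proof. exact: (scal_br Q2 (exceptional_center exR)). Qed.

Lemma exceptional_artin_schreier : exists (x : Q) (n : C),
  x * x = x + n%:A /\ exists z, br x z <> 0.
Proof.
exact: (exists_artin_schreier Q2 (exceptional_center exR)
  (exceptional_centralizer exR) (exceptional_noncomm exR)).
Qed.

Lemma exceptional_scal_br_br (y z y' z' : Q) : scal (br (br y z) (br y' z')).
Proof.
have [x [n [xx xz]]] := exceptional_artin_schreier.
exact: (scal_br_br Q2 (exceptional_centralizer exR) xx xz).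
Qed.

Lemma exceptional_br_br_neq0 : exists y z y' z' : Q, br (br y z) (br y' z') <> 0.
Proof.
have [x [n [xx xz]]] := exceptional_artin_schreier.
exact: (br_br_neq0 Q2 (exceptional_centralizer exR) (exceptional_simple exR) xx xz).
Qed.

Lemma exceptional_scal_br_comp (a b : Q) : (forall y, scal (br b (br a y))) ->
  scal a \/ forall y z, scal (br b (br y z)).
Proof.
have [x [n [xx xz]]] := exceptional_artin_schreier.
exact: (scal_br_comp Q2 (exceptional_centralizer exR) (exceptional_simple exR) xx xz).
Qed.

Lemma exceptional_scal_br_scale (e : Q) (l : C) :
  (forall y, scal (br e y + l *: y)) -> scal e /\ l = 0.
Proof.
have [x [n [xx xz]]] := exceptional_artin_schreier.
exact: (scal_br_scale Q2 (exceptional_center exR) (exceptional_centralizer exR) xx xz).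
Qed.

(** Induction principle expressing that [Q] is the [C]-span of any nonzero ideal of [R]. *)
Lemma Qs_span_ind I (P : Q -> Prop) : nz_ideal I ->
  (forall (c : C) a, I a -> P (c *: Qs_of a)) ->
  (forall x y, P x -> P y -> P (x - y)) -> forall q, P q.
Proof.
move=> nI PI PB q; elim: (exceptional_ideal_span exR q nI) => [_ [a [c [Ia ->]]]||x y _ hx _ hy].
- exact: PI.
- by case: nI => [[I0 _ _] _]; have := PI 0 0 I0; rewrite scale0r.
- exact: PB.
Qed.

Lemma scal_span (f : Q -> Q) : (forall x y, f (x - y) = f x - f y) ->
  (forall (c : C) x, f (c *: x) = c *: f x) ->
  (forall a, scal (f (Qs_of a))) -> forall q, scal (f q).
Proof.
move=> fB fZ h q.
move: q; apply: (Qs_span_ind (@nz_idealT R)) => [c a _|x y hx hy].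
  by rewrite fZ; apply: scalZ.
by rewrite fB oppr_char2 //; apply: scalD.
Qed.

Lemma br_subr (a x y : Q) : br a (x - y) = br a x - br a y.
Proof. by rewrite !oppr_char2 // brDr. Qed.

Lemma Qs_of_br (a b : R) : br (Qs_of a) (Qs_of b) = Qs_of (a ** b - b ** a).
Proof. by rewrite Qs_ofD Qs_ofN !Qs_ofM oppr_char2. Qed.

(** This identifies [Z(R)] with the intersection of [R] and [C]: what commutes with [R] commutes
    with its [C]-span [Q]. *)
Lemma rng_center_scal (z : R) : rng_center z <-> scal (Qs_of z).
Proof.
split=> [zc|/centroid_scal zc x]; last by apply: Qs_of_inj; rewrite !Qs_ofM zc.
apply: exceptional_center => //; apply: (Qs_span_ind (@nz_idealT R)) => [c a _|x y hx hy].
  by rewrite brZr Qs_of_br zc subrr Qs_of0 scaler0.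
by rewrite br_subr hx hy subrr.
Qed.

(** * Derivations of Q and their restriction to the center *)

Section Derivation.
Variable D : Q -> Q.
Hypothesis der_D : is_derivation *%R D.
Let DD : {morph D : x y / x + y}. Proof. by case: der_D. Qed.
Let DM x y : D (x * y) = x * D y + D x * y. Proof. by case: der_D. Qed.

Lemma derivation0 : D 0 = 0.
Proof. by apply: (addrI (D 0)); rewrite -DD !addr0. Qed.

Lemma derivation_scal c : scal c -> scal (D c).
Proof.
move=> /centroid_scal cc; apply/centroid_scal => y.
have : D (c * y) = D (y * c) by rewrite cc.
rewrite !DM (cc (D y)) [RHS]addrC => /addrI e.
by rewrite e.
Qed.

Lemma derivation_scalZ (c : C) y : D (c *: y) = c *: D y + D (c%:A) * y.
Proof. by rewrite -[c *: y]mul1r -scalerAr scalerAl DM -scalerAl mul1r. Qed.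

Lemma derivation_linear_inner : (forall c, scal c -> D c = 0) ->
  exists a, forall y, D y = br a y.
Proof.
move=> D0; have [x [n [xx xz]]] := exceptional_artin_schreier.
apply: (linear_derivation_inner Q2 (exceptional_centralizer exR) (exceptional_simple exR) xx xz).
  exact: der_D.
by move=> c y; rewrite derivation_scalZ (D0 c%:A) ?mul0r ?addr0 //; exists c.
Qed.

(* For s in an ideal that c multiplies into R, both g = [[s,r],[r',r'']] and   *)
(* cg lie in Z(R), so c is a fraction of central elements if g is nonzero.    *)
Lemma derivation_center0 : (forall z, rng_center z -> D (Qs_of z) = 0) ->
  forall c, scal c -> D c = 0.
Proof.
move=> D0 c sc; apply: contrapT => Dc0.
have [I nI hI] := Qs_absorb c.
suff g0 y z y' z' : br (br y z) (br y' z') = 0 :> Q.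
  by have [y [z [y' [z' []]]]] := exceptional_br_br_neq0.
(* The double bracket is [C]-linear in each entry, so the first entry may be taken in [I] and the
   other three in [R]. *)
move: y; apply: (Qs_span_ind nI) => [f s Is|y1 y2 h1 h2]; last first.
  by rewrite (brC _ z) br_subr brC br_subr !(brC (br y' z')) !(brC z) h1 h2 subrr.
rewrite 2!brZl.
move: z; apply: (Qs_span_ind (@nz_idealT R)) => [k r _|y1 y2 h1 h2]; last first.
  by rewrite br_subr brC br_subr !(brC (br y' z')) scalerBr h1 h2 subrr.
move: y'; apply: (Qs_span_ind (@nz_idealT R)) => [k' r' _|y1 y2 h1 h2]; last first.
  by rewrite (brC _ z') br_subr br_subr !(brC z') scalerBr h1 h2 subrr.
move: z'; apply: (Qs_span_ind (@nz_idealT R)) => [k'' r'' _|y1 y2 h1 h2]; last first.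
  by rewrite !br_subr scalerBr h1 h2 subrr.
rewrite !(brZr, brZl).
suff -> : br (br (Qs_of s) (Qs_of r)) (br (Qs_of r') (Qs_of r'')) = 0 :> Q.
  by rewrite !scaler0.
have [t et] : exists t, c * Qs_of s = Qs_of t by case: (hI s Is).
have gD u : D (br (br (Qs_of u) (Qs_of r)) (br (Qs_of r') (Qs_of r''))) = 0.
  by rewrite !Qs_of_br D0 //; apply/rng_center_scal;
    rewrite -!Qs_of_br; apply: exceptional_scal_br_br.
have [m em] := sc; have tE : Qs_of t = m *: Qs_of s by rewrite -et em -scalerAl mul1r.
(* For [g] the double bracket started at [s], both [D g] and [D (c * g)] vanish, so Leibniz leaves
   [D c * g = 0] with [D c] a nonzero scalar. *)
have := gD t; rewrite tE 2!brZl derivation_scalZ gD scaler0 add0r -em.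
have [e eDc] := derivation_scal sc; rewrite eDc -scalerAl mul1r => /eqP.
rewrite scaler_eq0 => /orP [/eqP e0|/eqP //].
by case: Dc0; rewrite eDc e0 scale0r.
Qed.

End Derivation.

(** A derivation vanishing on [Z(R)] vanishes on [C], hence is [C]-linear and therefore inner. *)
Lemma X_outer_center (d : R -> R) (D : Q -> Q) : extends_to_Qs d D -> X_outer d ->
  exists2 z, rng_center z & D (Qs_of z) <> 0.
Proof.
move=> ext; have [der_D _] := ext => out; apply: contrapT => H; apply: out.
have [|a ha] := derivation_linear_inner der_D.
  apply: derivation_center0 => // z zc; apply: contrapT => Dz; apply: H.
  by exists z.
by exists D => //; exists a => x; rewrite brE.
Qed.

(** * Compositions of two derivations with central values *)

Section Composition.
Variables (d delta : R -> R) (D Delta : Q -> Q).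
Hypotheses (extD : extends_to_Qs d D) (extDelta : extends_to_Qs delta Delta).

Let der_D : is_derivation *%R D. Proof. by case: extD. Qed.
Let der_Delta : is_derivation *%R Delta. Proof. by case: extDelta. Qed.
Let DR x : D (Qs_of x) = Qs_of (d x). Proof. by case: extD. Qed.
Let DeltaR x : Delta (Qs_of x) = Qs_of (delta x). Proof. by case: extDelta. Qed.

Lemma comp_center_scal : (forall x, rng_center (delta (d x))) <->
  (forall x, scal (Delta (D (Qs_of x)))).
Proof.
by split=> h x; [rewrite DR DeltaR|]; apply/rng_center_scal; rewrite -?DeltaR -?DR.
Qed.

Lemma comp_center_bilinear z x : (forall x, rng_center (delta (d x))) -> rng_center z ->
  scal (Delta (Qs_of z) * D (Qs_of x) + D (Qs_of z) * Delta (Qs_of x)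
        + Delta (D (Qs_of z)) * Qs_of x).
Proof.
move=> /comp_center_scal h zc; have [DD DM] := der_D; have [ED EM] := der_Delta.
have := h (z ** x); rewrite Qs_ofM DM ED !EM.
have [c ec] : scal (Qs_of z) by apply/rng_center_scal.
rewrite {1}ec -scalerAl mul1r -!addrA => e.
exact: (scalDl Q2 (scalZ c (h x)) e).
Qed.

End Composition.

Lemma comp_outer_inner_eq0 (a : Q) (e : C) : e != 0 ->
  (forall x : R, scal (e *: br a (Qs_of x))) -> forall y, br a y = 0.
Proof.
move=> e0 h y; apply: br_scal => //; apply: exceptional_scal_br => {}y.
apply: (@scal_span (br a)) => [u v|c u|x]; [exact: br_subr|exact: brZr|].
by have := scalZ e^-1 (h x); rewrite scalerA mulVf // scale1r.
Qed.


Lemma Qs_of_neq0 (a : R) : Qs_of a <> 0 -> a <> 0.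
Proof. by apply: contra_not => ->. Qed.

Lemma ext_eq0 (d : R -> R) (D : Q -> Q) : extends_to_Qs d D ->
  (forall y, D y = 0) -> forall x, d x = 0.
Proof. by move=> [_ DR] D0 x; apply: Qs_of_eq0; rewrite -DR D0. Qed.

Lemma derivation_brC (D : Q -> Q) a c : (forall y, D y = br a y) -> scal c -> D c = 0.
Proof. by move=> -> sc; rewrite brC br_scal. Qed.

Lemma scal_unit (e : Q) : scal e -> e <> 0 -> exists2 c : C, c != 0 & e = c%:A.
Proof.
move=> [c ->] c0; exists c => //; apply/eqP => c00.
by apply: c0; rewrite c00 scale0r.
Qed.

(** Choose [z] in [Z(R)] with [D z] nonzero. Being inner, [Delta] kills the scalars [z] and [D z],
    so the bilinear relation reduces to [D z * Delta x] in [C]. *)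
Lemma outer_inner_center (d delta : R -> R) (D Delta : Q -> Q) (b : Q) :
  extends_to_Qs d D -> extends_to_Qs delta Delta -> X_outer d ->
  (forall y, Delta y = br b y) -> (forall x, rng_center (delta (d x))) ->
  forall x, delta x = 0.
Proof.
move=> extD extDelta out Db h; apply: (ext_eq0 extDelta) => y; rewrite Db.
have [z zc Dz] := X_outer_center extD out.
have sz : scal (Qs_of z) by apply/rng_center_scal.
have [der_D _] := extD; have sDz := derivation_scal der_D sz.
have [e e0 eDz] := scal_unit sDz Dz.
apply: (comp_outer_inner_eq0 e0) => x.
have := comp_center_bilinear extD extDelta x h zc.
rewrite (derivation_brC Db sz) (derivation_brC Db sDz) !mul0r add0r addr0.
by rewrite eDz -scalerAl mul1r Db.
Qed.

(** Now [Delta z] is nonzero and [D z = 0], so only [Delta z * D x] survives in the bilinear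
    relation. *)
Lemma inner_outer_center (d delta : R -> R) (D Delta : Q -> Q) (a : Q) :
  extends_to_Qs d D -> extends_to_Qs delta Delta -> X_outer delta ->
  (forall y, D y = br a y) -> (forall x, rng_center (delta (d x))) ->
  forall x, d x = 0.
Proof.
move=> extD extDelta out Da h; apply: (ext_eq0 extD) => y; rewrite Da.
have [z zc Dz] := X_outer_center extDelta out.
have sz : scal (Qs_of z) by apply/rng_center_scal.
have [der_D _] := extD; have [der_Delta _] := extDelta.
have [e e0 eDz] := scal_unit (derivation_scal der_Delta sz) Dz.
apply: (comp_outer_inner_eq0 e0) => x.
have := comp_center_bilinear extD extDelta x h zc.
rewrite (derivation_brC Da sz) (derivation0 der_Delta) !mul0r !addr0.
by rewrite eDz -scalerAl mul1r Da.
Qed.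

Lemma inner_inner_center (d delta : R -> R) (D Delta : Q -> Q) (a b : Q) :
  extends_to_Qs d D -> extends_to_Qs delta Delta ->
  (forall y, D y = br a y) -> (forall y, Delta y = br b y) ->
  (forall x, rng_center (delta (d x))) <->
  (forall x, d x = 0) \/ (forall x, rng_comm_sub x -> rng_center (delta x)).
Proof.
move=> extD extDelta Da Db; have [_ DeltaR] := extDelta.
rewrite (comp_center_scal extD extDelta); split=> [h|].
  have [|sa|sb] := @exceptional_scal_br_comp a b.
  - apply: scal_span => [u v|c u|x]; [by rewrite !br_subr|by rewrite !brZr|].
    by rewrite -Da -Db.
  - by left; apply: (ext_eq0 extD) => y; rewrite Da br_scal.
  - right=> x cx; apply/rng_center_scal; rewrite -DeltaR Db.
    elim: cx => [_ [y [z ->]]||y z _ hy _ hz].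
    + by rewrite -Qs_of_br.
    + by rewrite Qs_of0 /br mulr0 mul0r addr0; exists 0; rewrite scale0r.
    + by rewrite Qs_ofD Qs_ofN br_subr oppr_char2 //; apply: scalD.
case=> [d0|h] x.
  have [_ DR] := extD; rewrite DR d0 Qs_of0 (derivation0 (proj1 extDelta)).
  by exists 0; rewrite scale0r.
rewrite Da Db; move: (Qs_of x) => y.
have {}h u v : scal (br b (br (Qs_of u) (Qs_of v))).
  rewrite Qs_of_br -Db DeltaR; apply/rng_center_scal/h.
  by apply: add_span_gen; exists u, v.
have {}h u : scal (br b (br u y)).
  move: y; apply: scal_span => [v w|c v|v]; [by rewrite !br_subr|by rewrite !brZr|].
  move: u; apply: (@scal_span (fun u => br b (br u (Qs_of v)))) => [w w'|c w|w] //.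
    by rewrite (brC _ (Qs_of v)) !br_subr !(brC (Qs_of v)).
  by rewrite brZl brZr.
exact: h.
Qed.

Lemma derivationD (D E : Q -> Q) (p q : C) :
  is_derivation *%R D -> is_derivation *%R E ->
  is_derivation *%R (fun y => p *: D y + q *: E y).
Proof.
move=> [DD DM] [ED EM]; split=> y z.
  by rewrite DD ED !scalerDr addrACA.
rewrite DM EM !scalerDr mulrDr mulrDl -!scalerAr -!scalerAl.
exact: addrACA.
Qed.

(** The cross term [2 D(y) D(z)] vanishes in characteristic two. *)
Lemma derivation_sq (D : Q -> Q) : is_derivation *%R D ->
  is_derivation *%R (fun y => D (D y)).
Proof.
move=> [DD DM]; split=> y z; first by rewrite !DD.
by rewrite DM DD !DM -addrA (addrA (D y * D z)) Q2 add0r.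
Qed.

Lemma outer_outer_center (d delta : R -> R) (D Delta : Q -> Q) :
  extends_to_Qs d D -> extends_to_Qs delta Delta -> X_outer d -> X_outer delta ->
  (forall x, rng_center (delta (d x))) ->
  exists beta : R,
    [/\ rng_center beta, d beta <> 0, delta beta <> 0,
        forall x, delta beta ** d x = d beta ** delta x &
        forall x, d (d x) = 0].
Proof.
move=> extD extDelta outD outDelta h.
have [der_D DR] := extD; have [der_Delta DeltaR] := extDelta.
(* Put [E = Delta(z) D + D(z) Delta] and [l = Delta(D(z))]. Then [E x + l x] is scalar on [R]. Once
   [E] is shown to kill [Z(R)] it is inner, say the bracket with [g], and the scalar condition
   forces [g] scalar and [l = 0], so [E = 0]. *)
have key z : rng_center z -> exists p q : C,
  [/\ Delta (Qs_of z) = p%:A, D (Qs_of z) = q%:A, Delta (D (Qs_of z)) = 0 &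
      forall y, p *: D y + q *: Delta y = 0].
  move=> zc; have sz : scal (Qs_of z) by apply/rng_center_scal.
  have [p ep] := derivation_scal der_Delta sz.
  have sDz := derivation_scal der_D sz; have [q eq] := sDz.
  have [l el] := derivation_scal der_Delta sDz.
  exists p, q; pose E y := p *: D y + q *: Delta y.
  have der_E : is_derivation *%R E by exact: derivationD.
  have sE x : scal (E (Qs_of x) + l *: Qs_of x).
    have := comp_center_bilinear extD extDelta x h zc.
    by rewrite el ep eq -!scalerAl !mul1r.
  have E0 w : rng_center w -> E (Qs_of w) = 0.
    move=> wc; have sw : scal (Qs_of w) by apply/rng_center_scal.
    have [c ec] := sw; apply: contrapT => Ew.
    have [e e0 eEw] := scal_unit (derivation_scal der_E sw) Ew.
    (* Compare the scalar condition at [w ** x] with [w] times the condition at [x]: the difference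
       is [E(w) x]. A nonzero [E(w)] would make all of [Q] scalar. *)
    have sx x : scal (e *: Qs_of x).
      have := sE (w ** x); rewrite Qs_ofM (proj2 der_E) {1 3}ec -!scalerAl !mul1r.
      rewrite eEw -scalerAl mul1r scalerA (mulrC l) -scalerA.
      rewrite addrAC -scalerDr => s; exact: (scalDl Q2 (scalZ c (sE x)) s).
    have sx' (y : Q) : scal y.
      move: y; apply: (@scal_span id) => // x.
      by have := scalZ e^-1 (sx x); rewrite scalerA mulVf // scale1r.
    by have [u [v []]] := exceptional_noncomm exR; apply: br_scal.
  have [g Eg] := derivation_linear_inner der_E (derivation_center0 der_E E0).
  have [|sg l0] := @exceptional_scal_br_scale g l.
    apply: (@scal_span (fun y => br g y + l *: y)) => [y y'|c y|x].
    - by rewrite br_subr scalerBr (opprD (br g y')) addrACA.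
    - by rewrite brZr [RHS]scalerDr !scalerA (mulrC l).
    - by rewrite -Eg.
  split=> //; first by rewrite el l0 scale0r.
  by move=> y; rewrite -/(E y) Eg br_scal.
have [z zc Dz] := X_outer_center extD outD.
have [p [q [ep eq _ E0]]] := key z zc.
(* If [Delta z = 0], then [E = 0] reads [D(z) Delta = 0], so [Delta] would vanish, although it is
   nonzero somewhere on [Z(R)]. *)
have Deltaz : Delta (Qs_of z) <> 0.
  move=> p0; have [z' zc' []] := X_outer_center extDelta outDelta.
  have [e e0 eDz] := scal_unit (derivation_scal der_D ((rng_center_scal z).1 zc)) Dz.
  have := E0 (Qs_of z'); rewrite -[p *: _]mul1r -[q *: _]mul1r -!scalerAr !scalerAl.
  rewrite -ep -eq p0 mul0r add0r eDz -scalerAl mul1r => /eqP.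
  by rewrite scaler_eq0 (negPf e0) => /eqP.
have p0 : p != 0 by apply: contra_not_neq Deltaz => p0; rewrite ep p0 scale0r.
(* Evaluating [E = 0] at [D y] gives [p *: D (D y) = q *: Delta (D y)]. *)
have pDD y : scal (Delta (D y)) -> scal (D (D y)).
  move=> [c ec]; exists (p^-1 * (q * c)).
  rewrite -!scalerA -ec; apply: (scalerI p0); rewrite [RHS]scalerA divff // scale1r.
  exact: (addr_eq0_char2 Q2 (E0 (D y))).
(* On [Z(R)] the composite [Delta D] vanishes by [key], hence so does the derivation [D D], which is
   therefore inner; its scalar values then make it zero. *)
have [g Dg] : exists g, forall y, D (D y) = br g y.
  have der_DD := derivation_sq der_D.
  apply: (derivation_linear_inner der_DD); apply: (derivation_center0 der_DD) => w wc.
  have [_ [_ [_ _ w0 _]]] := key w wc.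
  have /eqP := E0 (D (Qs_of w)).
  by rewrite w0 scaler0 addr0 scaler_eq0 (negPf p0) => /eqP.
have DD0 y : D (D y) = 0.
  rewrite Dg; apply: br_scal => //; apply: exceptional_scal_br => {}y.
  apply: (@scal_span (br g)) => [u v|c u|x]; [exact: br_subr|exact: brZr|].
  by rewrite -Dg; apply: pDD; apply: (comp_center_scal extD extDelta).1.
exists z; split=> //.
- by apply: Qs_of_neq0; rewrite -DR.
- by apply: Qs_of_neq0; rewrite -DeltaR.
- move=> x; apply: Qs_of_inj; rewrite !Qs_ofM -!DR -!DeltaR ep eq -!scalerAl !mul1r.
  exact: (addr_eq0_char2 Q2 (E0 (Qs_of x))).
- by move=> x; apply: Qs_of_eq0; rewrite -!DR DD0.
Qed.

End ExceptionalDerivations.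

Theorem theorem8p3 (R : primeRngType) (delta d : R -> R)
    (exR : exceptional R)
    (der_delta : is_derivation (@rng_mul R) delta)
    (der_d : is_derivation (@rng_mul R) d) :
  [/\ X_inner d -> X_outer delta ->
        ((forall x, rng_center (delta (d x))) <-> (forall x, d x = 0)),
      X_inner d -> X_inner delta ->
        ((forall x, rng_center (delta (d x))) <->
         (forall x, d x = 0) \/
         (forall x, rng_comm_sub x -> rng_center (delta x))),
      X_outer d -> X_inner delta ->
        ((forall x, rng_center (delta (d x))) <->
         (forall x, delta x = 0)) &
      X_outer delta -> X_outer d ->
        ((forall x, rng_center (delta (d x))) <->
         exists beta : R,
           [/\ rng_center beta, d beta <> 0, delta beta <> 0,
               forall x, delta beta ** d x = d beta ** delta x &
               forall x, d (d x) = 0])].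
Proof.
have Q2 := exceptional_addxx exR.
(* These extensions serve the X-outer derivations; an X-inner one brings its own extension with
   it. *)
have extD := Qs_der_extends der_d; have extDelta := Qs_der_extends der_delta.
have center0 : rng_center (0 : R) by move=> x; rewrite rng_mul0l rng_mul0r.
have delta0 : delta 0 = 0.
  by have [dD _] := der_delta; apply: (addrI (delta 0)); rewrite -dD !addr0.
split.
- move=> [D extD' [a Da]] out; split=> [h|d0 x]; last by rewrite d0 delta0.
  apply: (inner_outer_center exR extD' extDelta out _ h) => y.
  by rewrite Da brE.
- move=> [D extD' [a Da]] [Delta extDelta' [b Db]].
  by apply: (inner_inner_center exR extD' extDelta') => y; rewrite (Da, Db) brE.
- move=> out [Delta extDelta' [b Db]]; split=> [h|d0 x]; last by rewrite d0.
  apply: (outer_inner_center exR extD extDelta' out _ h) => y.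
  by rewrite Db brE.
move=> outDelta outD; split=> [|[beta [bc db _ e dd0]] x].
  exact: (outer_outer_center exR extD extDelta).
(* The nonzero [d beta] is central, and [d beta ** delta (d x) = delta beta ** d (d x) = 0], so
   primeness gives even [delta (d x) = 0]. *)
have dbc y : d beta ** y = y ** d beta.
  have [_ dM] := der_d; have : d (beta ** y) = d (y ** beta) by rewrite bc.
  by rewrite !dM bc [RHS]addrC => /addrI.
case: (@prime_rngP R (d beta) (delta (d x))) => [r|//|-> //].
by rewrite dbc -rng_mulA -e dd0 !rng_mul0r.
Qed.
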